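(* Let $G=(V,E)$ be a $4$-regular simple pfaffian graph on an even number of vertices. Then the number of perfect matchings of $G$ is at most $4^{\frac{|V|}{4}}$. Moreover, if $G$ is planar (and $4$-regular, simple, with $|V|$ even), then the number of perfect matchings of $G$ equals $4^{\frac{|V|}{4}}$ if and only if $G$ is a disjoint union of copies of the octahedron graph.
   Context: Graphs are finite. For an orientation of the edges of $G$, the skew symmetric adjacency matrix is $S(G)=[s_{uv}]_{u,v\in V}$ with $s_{uv}=1$ if the edge $(u,v)\in E$ is oriented from $u$ to $v$, $s_{uv}=-1$ if it is oriented from $v$ to $u$, and $s_{uv}=0$ if $(u,v)\notin E$. $G$ is pfaffian if it has an orientation with $\det S(G)$ equal to the square of the number of perfect matchings of $G$. (Every planar graph is pfaffian, by a theorem of Kasteleyn.) The octahedron graph is the $4$-regular graph on $6$ vertices obtained from $K_6$ by deleting the $3$ edges of a perfect matching. *)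

(* Defs.v *)
From HB Require Import structures.
From mathcomp Require Import all_boot all_order all_algebra.
From mathcomp Require Import all_classical all_reals all_analysis.
Set Implicit Arguments.
Unset Strict Implicit.
Unset Printing Implicit Defensive.
Import Order.TTheory GRing.Theory Num.Theory.
Import numFieldNormedType.Exports.
Local Open Scope ring_scope.

(* A finite simple graph is a symmetric irreflexive relation [e : rel V] on a
   finite type [V]. *)

Definition regular_graph (V : finType) (e : rel V) (d : nat) : Prop :=
  forall v : V, #|[set w | e v w]%SET| = d.

Definition edges (V : finType) (e : rel V) : {set {set V}} :=
  [set [set p.1; p.2]%SET | p : V * V & e p.1 p.2]%SET.

Definition perfect_matching (V : finType) (e : rel V) (M : {set {set V}}) : bool :=
  (M \subset edges e) && finset.partition M [set: V]%SET.

Definition num_perfect_matchings (V : finType) (e : rel V) : nat :=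
  #|[set M | perfect_matching e M]%SET|.

(* [o u v] means that the edge uv is oriented from u to v. *)
Definition orientation (V : finType) (e o : rel V) : Prop :=
  subrel o e /\ forall u v, e u v -> o u v (+) o v u.

(* The rows and columns are listed in the order of [enum V]; the determinant
   does not depend on this choice. *)
Definition skew_adjacency (V : finType) (o : rel V) : 'M[int]_#|V| :=
  \matrix_(i, j)
    if o (enum_val i) (enum_val j) then 1
    else if o (enum_val j) (enum_val i) then -1 else 0.

Definition pfaffian (V : finType) (e : rel V) : Prop :=
  exists o : rel V, orientation e o /\
    \det (skew_adjacency o) = ((num_perfect_matchings e) ^ 2)%N%:Z.

(* A drawing of a graph in the plane without crossings: [p v] is the point
   representing v, and [c u v], restricted to [0, 1], is a simple arc from
   [p u] to [p v] representing the edge uv.  [c v u] is the same arc traversed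
   backwards, so the non-crossing condition only concerns edges uv and wx that
   are distinct as unordered pairs. *)
Definition plane_drawing (R : realType) (V : finType) (e : rel V)
    (p : V -> R * R) (c : V -> V -> R -> R * R) : Prop :=
  [/\ injective p,
      forall u v, e u v ->
        [/\ {within `[0, 1], continuous (c u v)}%classic,
            {in `[0, 1] &, injective (c u v)},
            c u v 0 = p u, c u v 1 = p v &
            forall t, t \in `[0, 1] -> c v u t = c u v (1 - t)],
      forall u v x t, e u v -> t \in `]0, 1[ -> c u v t <> p x &
      forall u v w x s t, e u v -> e w x ->
        [set u; v]%SET != [set w; x]%SET ->
        s \in `]0, 1[ -> t \in `[0, 1] -> c u v s <> c w x t].

Definition planar (R : realType) (V : finType) (e : rel V) : Prop :=
  exists (p : V -> R * R) (c : V -> V -> R -> R * R), plane_drawing e p c.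

Definition isomorphic (V W : finType) (e : rel V) (e' : rel W) : Prop :=
  exists f : V -> W, bijective f /\ forall u v, e' (f u) (f v) = e u v.

(* K_6 with the perfect matching {01, 23, 45} deleted. *)
Definition octahedron : rel 'I_6 :=
  [rel i j : 'I_6 | (i != j) && (i./2 != j./2)].

Definition copies (k : nat) (V : finType) (e : rel V) : rel ('I_k * V) :=
  [rel x y : 'I_k * V | (x.1 == y.1) && e x.2 y.2].

Definition union_of_octahedra (V : finType) (e : rel V) : Prop :=
  exists k : nat, isomorphic e (@copies k _ octahedron).

(* Main.v *)
(* Hadamard's inequality gives the bound: all rows of a skew adjacency matrix have
   squared norm 4.

   For a plane graph, sampling the arcs into polygons gives numbers f(a, w) mod 2 (how
   often the arc a passes below the vertex w) such that two independent edges, drawn as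
   chords of a convex polygon, cross with parity f(a, w) + f(a, x) + f(b, u) + f(b, v),
   where a = uv and b = wx.  This replaces all topology.  Summed over the pairs of edges
   of a perfect matching, it gives a Kasteleyn orientation, hence the square of the
   number of perfect matchings is at most the determinant of a signed adjacency matrix.
   When the bound is attained, equality in Hadamard's inequality makes the rows
   orthogonal, so any two vertices have an even number of common neighbours.  The same
   numbers f exclude subdivisions of K5 and K33, and then the vertices come in pairs of
   twins with equal neighbourhoods, and two pairs inside the neighbourhood of a vertex
   are completely joined: every component is an octahedron.

   Conversely, each octahedron has eight perfect matchings. *)
Require Import Defs.
From mathcomp Require Import all_boot all_order all_fingroup all_algebra all_field.
From mathcomp Require Import all_classical all_reals all_analysis.
From mathcomp Require Import ring lra zify.
From Stdlib Require Import Btauto.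
Set Implicit Arguments.
Unset Strict Implicit.
Unset Printing Implicit Defensive.
Import Order.TTheory GRing.Theory Num.Theory.
Import numFieldNormedType.Exports.
Local Open Scope ring_scope.

(** * Pfaffians and Hadamard's inequality *)

(** The factor 2 ^ m * m! is never divided out: the standard matching matrix [std_skew], of
    determinant 1, serves as unit. Let N be the number of perfect matchings, and c and Q the values
    of [pfsum] at [std_skew] and at the Kasteleyn matrix K. Then N * c <= Q and Q ^ 2 = det K * c ^
    2, so N ^ 2 <= det K; Hadamard for 2m rows gives N ^ 4 <= 4 ^ (2m), that is N <= 2 ^ m.
    Orthogonality of two rows says that a sum of signs, one for each common neighbour, is zero,
    whence the evenness. Working with the faces of the drawing would call for the Jordan curve
    theorem; the numbers f only need crossings of segments and compactness. *)

Definition evn m (i : 'I_m) : 'I_m.*2 := Ordinal (etrans (ltn_double i m) (ltn_ord i)).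
Definition odn m (i : 'I_m) : 'I_m.*2 := Ordinal (etrans (ltn_Sdouble i m) (ltn_ord i)).

Lemma big_ord_double (R : Type) (idx : R) (op : Monoid.com_law idx) m
    (F : 'I_m.*2 -> R) :
  \big[op/idx]_j F j = \big[op/idx]_(i < m) op (F (evn i)) (F (odn i)).
Proof.
elim: m F => [|m IHm] F; first by rewrite !big_ord0.
rewrite (@big_ord_recr _ _ op m.*2.+1 F) (@big_ord_recr _ _ op m.*2) IHm.
rewrite [RHS]big_ord_recr /= -Monoid.mulmA.
congr (op _ (op _ _)); [|by congr F; apply: val_inj..].
by apply: eq_bigr => i _; congr (op _ _); congr F; apply: val_inj.
Qed.

Lemma signr_big_addb (R : pzRingType) (I : Type) (r : seq I) (P : pred I) (F : I -> bool) :
  (-1) ^+ (\big[addb/false]_(i <- r | P i) F i) = \prod_(i <- r | P i) (-1) ^+ F i :> R.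
Proof.
exact: (@big_morph R bool (fun b : bool => (-1) ^+ b) 1 *%R false addb (signr_addb R)).
Qed.

(* Permuting the columns of the Vandermonde matrix of (0, ..., n-1) multiplies its
   determinant by the signature; compare the signs of the two product formulas. *)
Lemma odd_perm_inversions n (s : 'S_n) :
  odd_perm s = \big[addb/false]_(i < n) \big[addb/false]_(j < n) ((i < j)%N && (s j < s i)%N).
Proof.
pose a : 'rV[int]_n := \row_i (val i)%:Z.
have dV : \det (Vandermonde n (col_perm s a)) = (-1) ^+ s * \det (Vandermonde n a).
  have -> : Vandermonde n (col_perm s a) = col_perm s (Vandermonde n a).
    by apply/matrixP => i j; rewrite !mxE.
  by rewrite col_permE det_mulmx det_perm mulrC odd_permV.
have sgV (t : 'S_n) : Num.sg (\det (Vandermonde n (col_perm t a))) =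
    (-1) ^+ (\big[addb/false]_(i < n) \big[addb/false]_(j < n) ((i < j)%N && (t j < t i)%N)).
  rewrite det_Vandermonde signr_big_addb.
  rewrite (big_morph Num.sg (@sgrM _) (sgr1 _)); apply: eq_bigr => i _.
  rewrite signr_big_addb (big_morph Num.sg (@sgrM _) (sgr1 _)) big_mkcond.
  apply: eq_bigr => j _; rewrite !mxE; case: ltnP => //= ij.
  case: (ltngtP (t j) (t i)) => [ji|ji|/val_inj/perm_inj eij].
  - by rewrite ltr0_sg // subr_lt0 ltz_nat.
  - by rewrite gtr0_sg // subr_gt0 ltz_nat.
  - by rewrite eij ltnn in ij.
have : Num.sg (\det (Vandermonde n (col_perm s a))) =
       (-1) ^+ s * Num.sg (\det (Vandermonde n (col_perm 1%g a))).
  by rewrite dV sgrM col_perm1; congr (_ * _); case: (odd_perm s).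
rewrite !sgV [X in _ * (-1) ^+ nat_of_bool X]big1 ?mulr1; last first.
  move=> i _; rewrite big1 // => j _; rewrite !perm1.
  by apply/negbTE/negP => /andP[/ltnW]; rewrite leqNgt => /negP.
by case: odd_perm; case: (\big[_/_]_(_ < _) _).
Qed.

(* The Pfaffian of A times 2 ^ m * m!: every perfect matching of the index set is
   counted once for each way of listing it as the pairs (s 0, s 1), (s 2, s 3), ... *)
Definition pfsum (R : comNzRingType) m (A : 'M[R]_m.*2) : R :=
  \sum_(s : 'S_m.*2) (-1) ^+ s * \prod_(i < m) A (s (evn i)) (s (odn i)).

Lemma det_colsub_alt (R : comNzRingType) n (B : 'M[R]_n) (g : {ffun 'I_n -> 'I_n}) :
  \sum_(s : 'S_n) (-1) ^+ s * \prod_j B (s j) (g j) = \det (rowsub g B^T).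
Proof.
by apply: eq_bigr => s _; congr (_ * _); apply: eq_bigr => j _; rewrite !mxE.
Qed.

Fact half_ord_subproof m (j : 'I_m.*2) : (j./2 < m)%N.
Proof. by have := ltn_ord j; lia. Qed.

Definition half_ord m (j : 'I_m.*2) : 'I_m := Ordinal (half_ord_subproof j).

Lemma half_evn m (i : 'I_m) : half_ord (evn i) = i.
Proof. by apply: val_inj; rewrite /= doubleK. Qed.

Lemma half_odn m (i : 'I_m) : half_ord (odn i) = i.
Proof. by apply: val_inj; rewrite /= uphalf_double. Qed.

Lemma evn_odn_half m (j : 'I_m.*2) :
  j = if odd j then odn (half_ord j) else evn (half_ord j).
Proof.
apply: val_inj; rewrite -{1}[val j]odd_double_half.
by case: (odd j); rewrite /= ?add1n ?add0n.
Qed.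

Lemma sum_pairs_distr (R : comNzRingType) m (h : 'I_m -> 'I_m.*2 -> 'I_m.*2 -> R) :
  \prod_(i < m) \sum_k \sum_l h i k l =
  \sum_(g : {ffun 'I_m.*2 -> 'I_m.*2}) \prod_(i < m) h i (g (evn i)) (g (odn i)).
Proof.
under eq_bigr do rewrite pair_bigA.
rewrite bigA_distr_bigA.
pose gf (f : {ffun 'I_m -> 'I_m.*2 * 'I_m.*2}) : {ffun 'I_m.*2 -> 'I_m.*2} :=
  [ffun j : 'I_m.*2 => if odd j then (f (half_ord j)).2 else (f (half_ord j)).1].
pose fg (g : {ffun 'I_m.*2 -> 'I_m.*2}) : {ffun 'I_m -> 'I_m.*2 * 'I_m.*2} :=
  [ffun i : 'I_m => (g (evn i), g (odn i))].
rewrite [RHS](reindex gf); last first.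
  exists fg => [f|g] _; apply/ffunP => i; rewrite !ffunE /= ?odd_double /=.
    by rewrite half_evn half_odn; case: (f i).
  by rewrite [in RHS](evn_odn_half i); case: odd.
apply: eq_bigr => f _; apply: eq_bigr => i _; rewrite !ffunE /= odd_double /=.
by rewrite half_evn half_odn.
Qed.

(** Expanding every entry of B A B^T gives a sum over all maps [g] of the index set, with
    coefficient the determinant of the columns of [B] picked by [g]. It vanishes when [g] repeats a
    column and is [\det B] up to the sign of [g] otherwise, as in the Cauchy-Binet formula. *)
Lemma pfsum_congr (R : comNzRingType) m (B A : 'M[R]_m.*2) :
  pfsum (B *m A *m B^T) = \det B * pfsum A.
Proof.
pose D (g : {ffun 'I_m.*2 -> 'I_m.*2}) := \prod_(i < m) A (g (evn i)) (g (odn i)).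
transitivity (\sum_(g : {ffun 'I_m.*2 -> 'I_m.*2}) \det (rowsub g B^T) * D g).
  transitivity (\sum_(s : 'S_m.*2) \sum_(g : {ffun 'I_m.*2 -> 'I_m.*2})
     (-1) ^+ s * \prod_j B (s j) (g j) * D g).
    apply: eq_bigr => s _; under [RHS]eq_bigr do rewrite -mulrA.
    rewrite -mulr_sumr; congr (_ * _).
    under [RHS]eq_bigr do rewrite big_ord_double /D -big_split /=.
    rewrite -(sum_pairs_distr (fun i k l => B (s (evn i)) k * B (s (odn i)) l * A k l)).
    apply: eq_bigr => i _; rewrite mxE exchange_big /=; apply: eq_bigr => l _.
    rewrite !mxE mulr_suml; apply: eq_bigr => k _; rewrite mulrAC -!mulrA; congr (_ * _).
  rewrite exchange_big; apply: eq_bigr => g _; rewrite -mulr_suml; congr (_ * _).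
  exact: det_colsub_alt.
rewrite (bigID (fun g : {ffun _} => injectiveb g)) /= [X in _ + X]big1 ?addr0; last first.
  move=> g /injectivePn[j [k jk gjk]].
  by rewrite (determinant_alternate jk) ?mul0r // => i; rewrite !mxE gjk.
rewrite (reindex (@pval _)) /=; last first.
  exists (insubd (1%g : 'S_m.*2)) => [s|g] inj_g; first exact: valKd.
  exact: insubdK.
rewrite mulr_sumr; apply: eq_big => [s|s _]; first by rewrite (valP s).
have -> : rowsub (pval s) B^T = row_perm s B^T.
  by apply/matrixP => i j; rewrite !mxE -pvalE.
rewrite row_permE det_mulmx det_perm det_tr [_ * \det B]mulrC -mulrA.
congr (_ * (_ * _)); rewrite /D; apply: eq_bigr => i _.
by rewrite -!pvalE.
Qed.

Definition std_skew (R : comNzRingType) m : 'M[R]_m.*2 :=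
  \matrix_(i, j) if i./2 == j./2 then if (i < j)%N then 1 else if (j < i)%N then -1 else 0
                 else 0.

Lemma std_skewS (R : comNzRingType) m :
  std_skew R m.+1 = block_mx (std_skew R 1) 0 0 (std_skew R m) :> 'M[R]_(2 + m.*2).
Proof.
apply/matrixP => i j.
case: (split_ordP i) => i' ->; case: (split_ordP j) => j' ->.
- by rewrite block_mxEul !mxE.
- rewrite block_mxEur !mxE ifN //=.
  by case: i' => -[|[|]].
- rewrite block_mxEdl !mxE ifN //=.
  by case: j' => -[|[|]].
- by rewrite block_mxEdr !mxE.
Qed.

Lemma tr_std_skew (R : comNzRingType) m : (std_skew R m)^T = - std_skew R m.
Proof.
apply/matrixP => i j; rewrite !mxE [j./2 == _]eq_sym.
by case: ifP => _; rewrite ?oppr0 //; case: (ltngtP i j) => _; rewrite ?oppr0 ?opprK.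
Qed.

Lemma det_std_skew (R : comNzRingType) m : \det (std_skew R m) = 1.
Proof.
elim: m => [|m IHm]; first by rewrite det_mx00.
rewrite std_skewS (@det_ublock _ 2 m.*2) IHm mulr1.
rewrite (expand_det_row _ (0 : 'I_2)) 2!big_ord_recl big_ord0 /cofactor.
by rewrite !det_mx11 !mxE /=; ring.
Qed.

(** One step of symplectic elimination: a permutation moves a nonzero entry to position (0, 1), and
    the 2 x 2 block around it is split off by a Schur complement. *)
Lemma skew_block_step (F : numFieldType) n (A : 'M[F]_(2 + n)) :
    A^T = - A -> A != 0 ->
  exists (B : 'M[F]_(2 + n)) (D : 'M[F]_n), D^T = - D /\
    A = B *m block_mx (std_skew F 1 : 'M[F]_2) 0 0 D *m B^T.
Proof.
move=> skA nzA.
have AE i j : A j i = - A i j by have /matrixP/(_ i j) := skA; rewrite !mxE.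
have diag0 i : A i i = 0.
  by have /eqP := AE i i; rewrite -addr_eq0 -mulr2n mulrn_eq0 => /eqP.
have [[i j] /= nzij] : exists ij : 'I_(2 + n) * 'I_(2 + n), A ij.1 ij.2 != 0.
  apply/existsP; apply: contraNT nzA; rewrite negb_exists => /forallP zA.
  by apply/eqP/matrixP => i j; rewrite mxE; apply/eqP/negPn/(zA (i, j)).
have ij : j != i by apply: contraNneq nzij => ->; rewrite diag0.
pose i0 : 'I_(2 + n) := lshift n (0 : 'I_2); pose i1 : 'I_(2 + n) := lshift n (1 : 'I_2).
have i01 : i0 != i1 by [].
(* In [s] the factor [t2] acts first, hence its target [t1 j]: so [i0] goes to [i] and [i1] to [j]
   even if these pairs overlap. *)
pose t1 := tperm i0 i; pose t2 := tperm i1 (t1 j); pose s := (t2 * t1)%g.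
have s0 : s i0 = i.
  rewrite permM /t2 tpermD ?tpermL //.
  by rewrite -(inj_eq (@perm_inj _ t1)) /t1 tpermK tpermL.
have s1 : s i1 = j by rewrite permM /t2 tpermL tpermK.
pose A' : 'M[F]_(2 + n) := \matrix_(k, l) A (s k) (s l).
have A'E : A = perm_mx s^-1 *m A' *m (perm_mx s^-1)^T.
  rewrite tr_perm_mx invgK -row_permE -[s]invgK -col_permE.
  by apply/matrixP => k l; rewrite !mxE !invgK !permKV.
have skA' k l : A' k l = - A' l k by rewrite !mxE AE.
pose K : 'M[F]_2 := ulsubmx A'; pose X : 'M[F]_(2, n) := ursubmx A'; pose D0 := drsubmx A'.
have A'b : A' = block_mx K X (- X^T) D0.
  rewrite -[LHS]submxK; congr block_mx.
  by apply/matrixP => k l; rewrite !mxE AE.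
pose a := A i j.
(* T J T^T = (det T) J for every 2 x 2 matrix T, so a diagonal one of determinant [a] will do. *)
pose T : 'M[F]_2 := \matrix_(k, l) if k == l then if k == 0 then a else 1 else 0.
pose J : 'M[F]_2 := std_skew F 1.
have detT : \det T = a.
  rewrite (expand_det_row _ (0 : 'I_2)) 2!big_ord_recl big_ord0 /cofactor.
  by rewrite !det_mx11 !mxE /=; ring.
have KE : K = T *m J *m T^T.
  have K01 : K 0 1 = a by rewrite !mxE s0 s1.
  have K10 : K 1 0 = - a by rewrite !mxE s0 s1 AE.
  have K00 k : K k k = 0 by rewrite !mxE diag0.
  move: (K) K01 K10 K00 => K' K01 K10 K00.
  apply/matrixP => k l; rewrite !mxE 2!big_ord_recl big_ord0 !mxE !big_ord_recl !big_ord0 !mxE /=.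
  have ord2 (x : 'I_2) : x = 0 \/ x = 1 by case: x => -[|[|//]] p; [left|right]; apply: val_inj.
  by case: (ord2 k) => ->; case: (ord2 l) => ->; rewrite /= ?K00 ?K01 ?K10; ring.
have uTJ : T *m J \in unitmx.
  by rewrite unitmxE det_mulmx detT (@det_std_skew _ 1) mulr1 unitfE.
have skJ : J^T = - J by exact: (@tr_std_skew _ 1).
(* [Y] solves T J Y^T = X, and [D] below is the corresponding Schur complement. *)
pose Y := (invmx (T *m J) *m X)^T.
have XE : T *m J *m Y^T = X by rewrite trmxK mulKVmx.
pose D := D0 - Y *m J *m Y^T.
exists (perm_mx s^-1 *m block_mx T 0 Y 1%:M), D; split.
  rewrite /D linearB /= !trmx_mul trmxK skJ mulNmx mulmxN opprK mulmxA.
  rewrite [X in X + _ = _](_ : _ = - D0) ?opprB 1?addrC //.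
  by apply/matrixP => k l; rewrite !mxE AE.
rewrite A'E trmx_mul !mulmxA; congr (_ *m _); rewrite -!mulmxA; congr (_ *m _).
rewrite A'b tr_block_mx trmx0 trmx1 !mulmx_block.
rewrite !(mulmx0, mul0mx, mulmx1, mul1mx, addr0, add0r) !mulmxA -/J; congr block_mx.
- by rewrite KE.
- by rewrite XE.
- by rewrite -[in LHS]XE !trmx_mul trmxK skJ mulNmx mulmxN opprK mulmxA.
- by rewrite addrC subrK.
Qed.

Lemma block_diag_congr (R : comNzRingType) k n (B : 'M[R]_(k + n)) (K : 'M[R]_k) (C J : 'M[R]_n)
    (L := block_mx 1%:M 0 0 C) :
  B *m block_mx K 0 0 (C *m J *m C^T) *m B^T =
  (B *m L) *m block_mx K 0 0 J *m (B *m L)^T.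
Proof.
rewrite trmx_mul !mulmxA; congr (_ *m _); rewrite -!mulmxA; congr (_ *m _).
rewrite tr_block_mx !mulmx_block.
by rewrite !(trmx0, trmx1, mulmx0, mul0mx, mulmx1, mul1mx, addr0, add0r).
Qed.

(* [B] need not be invertible, so that singular matrices are covered too. *)
Lemma skew_normal_form (F : numFieldType) m (A : 'M[F]_m.*2) :
  A^T = - A -> exists B, A = B *m std_skew F m *m B^T.
Proof.
elim: m => [|m IHm] in A *.
  by exists 0; apply/matrixP => -[].
have [->|nzA] := eqVneq A 0; first by exists 0; rewrite !mul0mx.
move=> skA; have [B [D [skD ->]]] := @skew_block_step F m.*2 A skA nzA.
have [C ->] := IHm D skD.
exists (B *m (block_mx 1%:M 0 0 C : 'M[F]_(2 + m.*2))); rewrite (std_skewS _ m).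
by rewrite -(@block_diag_congr F 2 m.*2 B (std_skew F 1) C (std_skew F m)).
Qed.

(** This is Pf(A) ^ 2 = det A up to normalisation: for A = B J B^T both sides carry the factor (det
    B) ^ 2, and J has determinant 1. *)
Lemma sqr_pfsum (F : numFieldType) m (A : 'M[F]_m.*2) :
  A^T = - A -> pfsum A ^+ 2 = \det A * pfsum (std_skew F m) ^+ 2.
Proof.
move=> /skew_normal_form[B ->].
by rewrite pfsum_congr !det_mulmx det_tr det_std_skew mulr1 exprMn.
Qed.

(* The eigenvalues of [H] are nonnegative with mean [c]: this is AM-GM for them. *)
Lemma hadamard (C : numClosedFieldType) n (A : 'M[C]_n) (c : C)
    (H := A *m map_mx Num.conj A^T) :
  (forall i, H i i = c) ->
  `|\det A| ^+ 2 <= c ^+ n /\ (`|\det A| ^+ 2 = c ^+ n -> H = c%:M).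
Proof.
move=> diagH; case: n A @H diagH => [|n] A H diagH.
  by rewrite det_mx00 normr1 !expr1n expr0 lexx; split=> // _; apply/matrixP => -[].
have /orthomx_spectralP HE : H \is normalmx.
  by apply/normalmxP; rewrite /H trmx_mul map_mxM map_trmx trmxK -map_mx_comp (map_mx_id (@conjCK C)).
set P := spectralmx H in HE; set sp := spectral_diag H in HE.
have uP : P \is unitarymx by exact: spectral_unitarymx.
have Pu : P \in unitmx by exact: spectral_unit.
(* In the eigenbasis [H] is the Gram matrix of the rows of [P *m A], so its eigenvalues are squared
   norms. *)
have diagE : diag_mx sp = (P *m A) *m map_mx Num.conj (P *m A)^T.
  rewrite trmx_mul map_mxM !mulmxA -(mulmxA P) -/H HE invmx_unitary // !mulmxA.
  by rewrite mulmxtVK // (unitarymxP _) // mul1mx.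
have sp_ge0 i : 0 <= sp 0 i.
  have /matrixP/(_ i i) := diagE; rewrite [LHS]mxE eqxx mulr1n => ->.
  rewrite mxE; apply: sumr_ge0 => k _; rewrite ![_ k i]mxE mxE.
  exact: mul_conjC_ge0.
have det_sp : \prod_i sp 0 i = `|\det A| ^+ 2.
  rewrite -det_diag diagE det_mulmx det_map_mx det_tr -normCK det_mulmx normrM exprMn.
  suff -> : `|\det P| ^+ 2 = 1 by rewrite mul1r.
  by rewrite normCK -det_tr -det_map_mx det_tr -det_mulmx (unitarymxP _) ?det1.
have PH : P *m H = diag_mx sp *m P by rewrite HE !mulmxA mulmxV // mul1mx.
have tr_sp : \sum_i sp 0 i = n.+1%:R * c.
  rewrite -mxtrace_diag -[diag_mx sp](mulmxK Pu) -PH mxtrace_mulC mulKmx //.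
  by rewrite /mxtrace (eq_bigr (fun _ => c)) // sumr_const card_ord mulr_natl.
have := @leif_AGM C 'I_n.+1 predT (fun i => sp 0 i) (fun i _ => sp_ge0 i).
rewrite cardT size_enum_ord.
have -> : (\sum_(i in predT) sp 0 i) / n.+1%:R = c.
  by rewrite tr_sp mulrAC mulfV ?mul1r ?pnatr_eq0.
rewrite det_sp => -[le_c eq_c]; split=> // /eqP.
rewrite eq_c => /forall_inP sp_const.
have sp0 i : sp 0 i = sp 0 0 by have /forall_inP/(_ 0 isT)/eqP := sp_const i isT.
have spc : sp 0 0 = c.
  move: tr_sp; rewrite (eq_bigr (fun _ => sp 0 0)) => [|i _]; last exact: sp0.
  rewrite sumr_const card_ord -[sp 0 0 *+ _]mulr_natl => /mulfI; apply.
  by rewrite pnatr_eq0.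
have -> : H = invmx P *m (diag_mx sp *m P) by rewrite mulmxA.
suff -> : diag_mx sp = c%:M by rewrite -scalar_mxC mulKmx.
by apply/matrixP => i j; rewrite !mxE sp0 spc.
Qed.

(** * The van Kampen obstruction of a plane drawing *)

Lemma addb_xorb (a b : bool) : a (+) b = xorb a b.
Proof. by case: a; case: b. Qed.

Ltac xor_tauto := rewrite ?addb_xorb; btauto.

(* When [lt] is the order of distinct points on a line, this says that the chords
   [a] and [b] interleave. *)
Definition crossing (T : Type) (lt : rel T) (a b : T * T) : bool :=
  lt a.1 b.1 (+) lt a.1 b.2 (+) lt a.2 b.1 (+) lt a.2 b.2.

(** The mod 2 boundary of the 1-chain [Z] is u + v, expressed by pairing with every function on the
    points; repeated edges of the list then cancel by themselves. *)
Definition chain_boundary (T : Type) (Z : seq (T * T)) (u v : T) : Prop :=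
  forall h : T -> bool, \big[addb/false]_(a <- Z) (h a.1 (+) h a.2) = h u (+) h v.

Definition chain_sum (T : Type) (f : T * T -> T -> bool) (Z : seq (T * T)) (w : T) : bool :=
  \big[addb/false]_(a <- Z) f a w.

(* The hypothesis on pairs of edges is additive in [a] and in [b], so it telescopes
   along the two chains. *)
Lemma chain_crossing (T : eqType) (lt : rel T) (f : T * T -> T -> bool)
    (Z Z' : seq (T * T)) (u v w x : T) :
  chain_boundary Z u v -> chain_boundary Z' w x ->
  {in Z & Z', forall a b,
     crossing lt a b = f a b.1 (+) f a b.2 (+) (f b a.1 (+) f b a.2)} ->
  crossing lt (u, v) (w, x) =
  chain_sum f Z w (+) chain_sum f Z x (+) (chain_sum f Z' u (+) chain_sum f Z' v).
Proof.
move=> bZ bZ' fZ.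
transitivity (\big[addb/false]_(a <- Z) \big[addb/false]_(b <- Z') crossing lt a b).
  transitivity (\big[addb/false]_(a <- Z) ((lt a.1 w (+) lt a.1 x) (+) (lt a.2 w (+) lt a.2 x))).
    by rewrite (bZ (fun s => lt s w (+) lt s x)) /crossing /= addbA.
  apply: eq_bigr => a _; have := bZ' (fun t => lt a.1 t (+) lt a.2 t).
  rewrite [X in X = _ -> _](eq_bigr (crossing lt a)) => [->|b _]; rewrite /crossing; xor_tauto.
transitivity (\big[addb/false]_(a <- Z) ((f a w (+) f a x) (+)
    \big[addb/false]_(b <- Z') (f b a.1 (+) f b a.2))).
  apply: eq_big_seq => a aZ; rewrite -(bZ' (f a)) -big_split /=.
  by apply: eq_big_seq => b bZ0; rewrite fZ.
rewrite !big_split /= -/(chain_sum f Z w) -/(chain_sum f Z x); congr (_ (+) _).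
rewrite exchange_big /=; under eq_bigr do rewrite (bZ (f _)).
by rewrite big_split.
Qed.

(** * Parities of crossings of straight segments *)

Section Segments.
Variable R : realFieldType.
Implicit Types (a b : (R * R) * (R * R)) (z : R * R).

Definition segment_point a (p : R) : R * R :=
  (a.1.1 + p * (a.2.1 - a.1.1), a.1.2 + p * (a.2.2 - a.1.2)).

Definition lt_fst : rel (R * R) := fun s t => s.1 < t.1.

Definition orient a z : R :=
  (a.2.1 - a.1.1) * (z.2 - a.1.2) - (a.2.2 - a.1.2) * (z.1 - a.1.1).

(* [below a z]: the segment [a] meets the vertical half-line going down from [z]. *)
Definition below a z : bool :=
  (lt_fst a.1 z (+) lt_fst a.2 z) && (0 < orient a z * (a.2.1 - a.1.1)).

Definition disjoint_segments a b : Prop :=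
  forall p q, 0 <= p <= 1 -> 0 <= q <= 1 -> segment_point a p <> segment_point b q.

Definition swap a := (a.2, a.1).

Lemma below_swap a z : below (swap a) z = below a z.
Proof.
by rewrite /below /orient /= addbC; congr (_ && (0 < _)); ring.
Qed.

Lemma segment_point_swap a p : segment_point (swap a) p = segment_point a (1 - p).
Proof. by congr pair; rewrite /=; ring. Qed.

Lemma disjoint_segments_swap a b : disjoint_segments a b -> disjoint_segments (swap a) b.
Proof.
move=> ab p q p01 q01; rewrite segment_point_swap; apply: ab => //.
by move: p01; lra.
Qed.

Lemma disjoint_segmentsC a b : disjoint_segments a b -> disjoint_segments b a.
Proof. by move=> ab p q p01 q01 /esym; apply: ab. Qed.

Let height a (x : R) : R := a.1.2 + (x - a.1.1) * ((a.2.2 - a.1.2) / (a.2.1 - a.1.1)).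

(** The product is [z.2 - height a z.1] times the square of the horizontal extent of [a], so the
    test in [below] is whether [z] is above the line of [a]. *)
Lemma orient_height a z : a.1.1 < a.2.1 ->
  (0 < orient a z * (a.2.1 - a.1.1)) = (0 < z.2 - height a z.1).
Proof.
move=> a12; have nz : a.2.1 - a.1.1 != 0 by rewrite subr_eq0 gt_eqF.
have -> : orient a z * (a.2.1 - a.1.1) = (z.2 - height a z.1) * (a.2.1 - a.1.1) ^+ 2.
  by rewrite /orient /height; field.
by rewrite pmulr_lgt0 // exprn_gt0 // subr_gt0.
Qed.

(** The difference of the two heights is affine; if it vanished or changed sign between [x0] and
    [x1], the segments would meet above its zero. *)
Lemma disjoint_segments_height a b x0 x1 :
    a.1.1 < a.2.1 -> b.1.1 < b.2.1 -> disjoint_segments a b ->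
    a.1.1 <= x0 <= a.2.1 -> a.1.1 <= x1 <= a.2.1 ->
    b.1.1 <= x0 <= b.2.1 -> b.1.1 <= x1 <= b.2.1 ->
  0 < (height b x0 - height a x0) * (height b x1 - height a x1).
Proof.
move=> a12 b12 ab ax0 ax1 bx0 bx1; rewrite ltNge; apply/negP => le0.
pose D x := height b x - height a x.
have [x [ax bx Dx]] : exists x, [/\ a.1.1 <= x <= a.2.1, b.1.1 <= x <= b.2.1 & D x = 0].
  have [D01|D01] := eqVneq (D x0) (D x1).
    exists x0; split=> //; move: le0; rewrite -/(D x0) -/(D x1) -D01 -expr2.
    by rewrite real_exprn_even_le0 ?num_real //= => /eqP.
  pose l := D x0 / (D x0 - D x1).
  have dnz : D x0 - D x1 != 0 by rewrite subr_eq0.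
  have Dl : D (x0 + l * (x1 - x0)) = 0.
    have -> : D (x0 + l * (x1 - x0)) = D x0 + l * (D x1 - D x0).
      by rewrite /D /height; ring.
    by rewrite /l; field.
  have l01 : 0 <= l <= 1.
    move: le0 dnz; rewrite -/(D x0) -/(D x1) {Dl} /l.
    move: (D x0) (D x1) D01 => y0 y1 D01 le0 dnz.
    have [y01|y01] : y0 <= 0 <= y1 \/ y1 <= 0 <= y0 by nra.
      have d0 : y0 - y1 < 0 by rewrite lt_neqAle dnz; lra.
      by rewrite ler_ndivlMr // ler_ndivrMr //; lra.
    have d0 : 0 < y0 - y1 by rewrite lt_neqAle eq_sym dnz; lra.
    by rewrite ler_pdivlMr // ler_pdivrMr //; lra.
  by exists (x0 + l * (x1 - x0)); split=> //; nra.
pose par (c : (R * R) * (R * R)) := (x - c.1.1) / (c.2.1 - c.1.1).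
have parP c : c.1.1 < c.2.1 -> c.1.1 <= x <= c.2.1 ->
    0 <= par c <= 1 /\ segment_point c (par c) = (x, height c x).
  move=> c12 cx; have d0 : 0 < c.2.1 - c.1.1 by lra.
  split; first by rewrite /par ler_pdivlMr // ler_pdivrMr //; lra.
  have nz : c.2.1 - c.1.1 != 0 by rewrite gt_eqF.
  by congr pair; rewrite /par /height; field.
have [pa ea] := parP a a12 ax; have [pb eb] := parP b b12 bx.
by apply: (ab _ _ pa pb); rewrite ea eb; congr pair; move: Dx; rewrite /D; lra.
Qed.

(* If the x-projections interleave, then exactly one of the two segments passes
   below an end point of the other; if they are nested, then the outer segment is
   below both or none of the end points of the inner one. *)
Lemma crossing_below a b :
    (a.1.1 = a.2.1 -> a.1 = a.2) -> (b.1.1 = b.2.1 -> b.1 = b.2) ->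
    [/\ a.1.1 != b.1.1, a.1.1 != b.2.1, a.2.1 != b.1.1 & a.2.1 != b.2.1] ->
    disjoint_segments a b ->
  crossing lt_fst a b = below a b.1 (+) below a b.2 (+) (below b a.1 (+) below b a.2).
Proof.
wlog ale : a / a.1.1 <= a.2.1.
  move=> hw ea eb [n1 n2 n3 n4] dab; have [|/ltW ale] := leP a.1.1 a.2.1.
    by move=> ?; apply: hw.
  have := hw (swap a) ale (fun e => esym (ea (esym e))) eb (And4 n3 n4 n1 n2)
             (disjoint_segments_swap dab).
  rewrite !below_swap /= => e; rewrite [below b _ (+) _]addbC -e /crossing /=; xor_tauto.
wlog ble : b / b.1.1 <= b.2.1.
  move=> hw ea eb [n1 n2 n3 n4] dab; have [|/ltW ble] := leP b.1.1 b.2.1.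
    by move=> ?; apply: hw.
  have := hw (swap b) ble ea (fun e => esym (eb (esym e))) (And4 n2 n1 n4 n3)
             (disjoint_segmentsC (disjoint_segments_swap (disjoint_segmentsC dab))).
  rewrite !below_swap /= => e; rewrite [below a _ (+) _]addbC -e /crossing /=; xor_tauto.
wlog ab : a b ale ble / a.1.1 < b.1.1.
  move=> hw ea eb [n1 n2 n3 n4] dab; have [lt_ab|ba|e] := ltgtP a.1.1 b.1.1.
  - exact: hw.
  - have := hw b a ble ale ba eb ea (And4 _ _ _ _) (disjoint_segmentsC dab).
    rewrite ![_ == a.1.1]eq_sym ![_ == a.2.1]eq_sym => /(_ n1 n3 n2 n4) e.
    rewrite addbC -e /crossing /lt_fst.
    have ltN (x y : R) : x != y -> (y < x) = ~~ (x < y).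
      by move=> xy; rewrite -leNgt le_eqVlt eq_sym (negbTE xy).
    rewrite !(ltN _ _ n1) !(ltN _ _ n2) !(ltN _ _ n3) !(ltN _ _ n4); xor_tauto.
  - by rewrite e eqxx in n1.
move=> ea eb [n1 n2 n3 n4] dab.
have ab2 := lt_le_trans ab ble.
rewrite /crossing /below /lt_fst ab ab2 (le_gtF (ltW ab)) (le_gtF (ltW ab2)) /=.
have [a2b1|b1a2|e] := ltgtP a.2.1 b.1.1; last by rewrite e eqxx in n3.
  have a2b2 := lt_le_trans a2b1 ble.
  by rewrite a2b2 (le_gtF (ltW a2b2)).
have a12 := lt_trans ab b1a2.
have [a2b2|b2a2|e] := ltgtP a.2.1 b.2.1; last by rewrite e eqxx in n4.
  have b12 := lt_trans b1a2 a2b2.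
  (* Over the overlap of the projections one segment stays above the other, so exactly one of [b.1]
     above [a] and [a.2] above [b] holds. *)
  have := @disjoint_segments_height a b b.1.1 a.2.1 a12 b12 dab.
  rewrite (ltW ab) (ltW b1a2) (ltW a12) (ltW b12) (ltW a2b2) !lexx => /(_ isT isT isT isT).
  rewrite /= !orient_height //.
  have -> : height b b.1.1 = b.1.2 by rewrite /height subrr mul0r addr0.
  have -> : height a a.2.1 = a.2.2.
    by rewrite /height mulrC divfK ?subr_eq0 ?gt_eqF // addrC subrK.
  move: (height a b.1.1) (height b a.2.1) => y z h.
  by case: (ltP 0 (b.1.2 - y)) => p; case: (ltP 0 (a.2.2 - z)) => q //; exfalso; nra.
(* The projections are nested. If [b] has zero width it is a single point, and its two equal end
   points cancel. *)
have [b12|b12] := eqVneq b.1.1 b.2.1.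
  by rewrite (eb b12) /=; xor_tauto.
have {}b12 : b.1.1 < b.2.1 by rewrite lt_neqAle b12.
have := @disjoint_segments_height a b b.1.1 b.2.1 a12 b12 dab.
rewrite (ltW ab) (ltW b1a2) (ltW ab2) (ltW b12) (ltW b2a2) !lexx => /(_ isT isT isT isT).
rewrite /= !orient_height //.
have -> : height b b.1.1 = b.1.2 by rewrite /height subrr mul0r addr0.
have -> : height b b.2.1 = b.2.2.
  by rewrite /height mulrC divfK ?subr_eq0 ?gt_eqF // addrC subrK.
move: (height a b.1.1) (height a b.2.1) => y z h.
by case: (ltP 0 (b.1.2 - y)) => p; case: (ltP 0 (b.2.2 - z)) => q //; exfalso; nra.
Qed.

End Segments.

(** * Inscribed polygons of disjoint arcs *)

Definition separated (R : realType) (f g : R -> R) (n : nat) (x : R * R) :=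
  forall s t p q, s \in `[0, 1] -> t \in `[0, 1] -> `|x.1 - s| <= n%:R^-1 ->
    `|x.2 - t| <= n%:R^-1 -> 0 <= p <= 1 -> 0 <= q <= 1 ->
    f x.1 + p * (f s - f x.1) <> g x.2 + q * (g t - g x.2).

Lemma near_le (R : realType) (f : R -> R) (s0 y : R) : s0 \in `[0, 1] -> {within `[0, 1], continuous f}%classic ->
  f s0 < y -> exists2 r : R, 0 < r & forall s, s \in `[0, 1] -> `|s0 - s| < r -> f s < y.
Proof.
move=> s01 /subspace_continuousP cf fy; have /cf{}cf : `[0, 1]%classic s0 by [].
have : \forall s \near within `[0, 1]%classic (nbhs s0), f s < y.
  exact: cvgr_lt cf _ fy.
rewrite near_withinE => /nbhs_ballP[r /= r0 br]; exists r => // s s1 ss.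
exact: br.
Qed.

Lemma near_ge (R : realType) (f : R -> R) (s0 y : R) : s0 \in `[0, 1] -> {within `[0, 1], continuous f}%classic ->
  y < f s0 -> exists2 r : R, 0 < r & forall s, s \in `[0, 1] -> `|s0 - s| < r -> y < f s.
Proof.
move=> s01 /subspace_continuousP cf fy; have /cf{}cf : `[0, 1]%classic s0 by [].
have : \forall s \near within `[0, 1]%classic (nbhs s0), y < f s.
  exact: cvgr_gt cf _ fy.
rewrite near_withinE => /nbhs_ballP[r /= r0 br]; exists r => // s s1 ss.
exact: br.
Qed.

(** The midpoint [y] of the two values separates [f] near [x0.1] from [g] near [x0.2], and by
    convexity chords stay on the side of their end points. *)
Lemma near_separated (R : realType) (f g : R -> R) (x0 : R * R) :
    {within `[0, 1], continuous f}%classic -> {within `[0, 1], continuous g}%classic ->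
    x0.1 \in `[0, 1] -> x0.2 \in `[0, 1] -> f x0.1 < g x0.2 ->
  \forall x \near x0 & n \near \oo%classic, x.1 \in `[0, 1] -> x.2 \in `[0, 1] -> separated f g n x.
Proof.
move=> cf cg x1 x2 fg; pose y := (f x0.1 + g x0.2) / 2.
have [|r r0 fr] := near_le (y := y) x1 cf; first by rewrite /y; lra.
have [|r' r'0 gr'] := near_ge (y := y) x2 cg; first by rewrite /y; lra.
(* Halved because [s] and [t] are reached in two moves, from [x0] to [x] and then within the mesh
   1/n. *)
pose d := Num.min r r' / 2.
have d0 : 0 < d by rewrite /d divr_gt0 // lt_min r0.
have dr : d * 2 <= r by rewrite /d divfK ?ge_min ?lexx.
have dr' : d * 2 <= r' by rewrite /d divfK ?ge_min ?lexx ?orbT.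
near=> x n => xs xt s t p q s1 t1 xns xnt p01 q01.
have nd' : d^-1 < n%:R by near: n; exact: nbhs_infty_gtr.
have n0 : (0 : R) < n%:R by apply: lt_trans nd'; rewrite invr_gt0.
have nd : n%:R^-1 < d by rewrite -[d]invrK ltf_pV2 ?posrE ?invr_gt0.
have [bx1 bx2] : ball x0 d x by near: x; exact: nbhsx_ballx.
have lt2 (a b c : R) : `|a - b| < d -> `|b - c| <= n%:R^-1 -> `|a - c| < d * 2.
  move=> ab bc; apply: le_lt_trans (ler_distD b a c) _; lra.
have fx : f x.1 < y by apply: fr => //; apply: lt_le_trans dr; apply: lt_trans bx1 _; lra.
have fs : f s < y by apply: fr => //; apply: lt_le_trans dr; exact: lt2 bx1 xns.
have gx : y < g x.2 by apply: gr' => //; apply: lt_le_trans dr'; apply: lt_trans bx2 _; lra.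
have gt : y < g t by apply: gr' => //; apply: lt_le_trans dr'; exact: lt2 bx2 xnt.
have conv (a b p' : R) : 0 <= p' <= 1 -> exists2 c, (a <= c <= b) || (b <= c <= a) & a + p' * (b - a) = c.
  move=> p'01; exists (a + p' * (b - a)) => //; apply/orP.
  by have [?|?] := lerP a b; [left|right]; nra.
have [z zf ->] := conv (f x.1) (f s) p p01; have [z' zg ->] := conv (g x.2) (g t) q q01.
by case/orP: zf => zf; case/orP: zg => zg; lra.
Unshelve. all: by end_near. Qed.

Lemma fst_snd_continuous (R : realType) (c : R -> R * R) : {within `[0, 1], continuous c}%classic ->
  {within `[0, 1], continuous (fst \o c)}%classic /\
  {within `[0, 1], continuous (snd \o c)}%classic.
Proof.
move=> /subspace_continuousP cc.
by split; apply/subspace_continuousP => x /cc; rewrite /from_subspace => cx;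
  apply: (cvg_comp _ _ cx); [exact: cvg_fst|exact: cvg_snd].
Qed.

Lemma near_separated_neq (R : realType) (f g : R -> R) (x0 : R * R) :
    {within `[0, 1], continuous f}%classic -> {within `[0, 1], continuous g}%classic ->
    x0.1 \in `[0, 1] -> x0.2 \in `[0, 1] -> f x0.1 <> g x0.2 ->
  \forall x \near x0 & n \near \oo%classic,
    x.1 \in `[0, 1] -> x.2 \in `[0, 1] -> separated f g n x.
Proof.
move=> cf cg x1 x2 /eqP; rewrite neq_lt => /orP[fg|gf]; first exact: near_separated.
have cN (h : R -> R) : {within `[0, 1], continuous h}%classic ->
    {within `[0, 1], continuous (fun t => - h t)}%classic.
  by move=> ch x; apply: continuousN; exact: ch.
have := @near_separated R (fun t => - f t) (fun t => - g t) x0 (cN f cf) (cN g cg) x1 x2.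
rewrite ltrN2 => /(_ gf); apply: filterS => -[x n] /= sep y1 y2 s t p q s1 t1 xs xt p01 q01 e.
by apply: (sep y1 y2 s t p q s1 t1 xs xt p01 q01); lra.
Qed.

(** At each pair of parameters the two points differ in some coordinate, and this coordinate
    separates all short chords nearby; compactness of the square of parameters makes the mesh
    uniform. *)
Lemma near_disjoint_segments (R : realType) (c d : R -> R * R) :
    {within `[0, 1], continuous c}%classic -> {within `[0, 1], continuous d}%classic ->
    (forall s t, s \in `[0, 1] -> t \in `[0, 1] -> c s <> d t) ->
  \forall n \near \oo%classic, forall i j, (i < n)%N -> (j < n)%N ->
    disjoint_segments (c (i%:R / n%:R), c (i.+1%:R / n%:R))
                      (d (j%:R / n%:R), d (j.+1%:R / n%:R)).
Proof.
move=> /fst_snd_continuous[cc1 cc2] /fst_snd_continuous[cd1 cd2] cd.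
pose P n (x : R * R) := forall s t p q, s \in `[0, 1] -> t \in `[0, 1] ->
  `|x.1 - s| <= n%:R^-1 -> `|x.2 - t| <= n%:R^-1 -> 0 <= p <= 1 -> 0 <= q <= 1 ->
  segment_point (c x.1, c s) p <> segment_point (d x.2, d t) q.
have nearP : \forall n \near \oo%classic, forall x : R * R,
    (`[(0 : R), 1] `*` `[(0 : R), 1])%classic x -> x.1 \in `[0, 1] -> x.2 \in `[0, 1] -> P n x.
  have cK : compact (`[(0 : R), 1] `*` `[(0 : R), 1])%classic.
    by apply: compact_setX; exact: segment_compact.
  apply: ((compact_near_coveringP _).1 cK) => x [/= x1 x2].
  have [e1|/eqP n1] := eqVneq (c x.1).1 (d x.2).1; last first.
    have := near_separated_neq cc1 cd1 x1 x2 n1.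
    apply: filterS => -[y n] /= sep y1 y2 s t p q s1 t1 xs xt p01 q01 [e _].
    exact: (sep y1 y2 s t p q s1 t1 xs xt p01 q01).
  have n2 : (c x.1).2 <> (d x.2).2.
    by move=> e2; apply: (cd _ _ x1 x2); rewrite (surjective_pairing (c _)) e1 e2 -surjective_pairing.
  have := near_separated_neq cc2 cd2 x1 x2 n2.
  apply: filterS => -[y n] /= sep y1 y2 s t p q s1 t1 xs xt p01 q01 [_ e].
  exact: (sep y1 y2 s t p q s1 t1 xs xt p01 q01).
have step n i : (i < n)%N -> [/\ i%:R / n%:R \in `[(0 : R), 1], i.+1%:R / n%:R \in `[(0 : R), 1]
    & `|i%:R / n%:R - i.+1%:R / n%:R| <= n%:R^-1 :> R].
  move=> lt_in; have n0 : (0 : R) < n%:R by rewrite ltr0n (leq_ltn_trans _ lt_in).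
  split.
  - by rewrite in_itv /= divr_ge0 //= ler_pdivrMr // mul1r ler_nat ltnW.
  - by rewrite in_itv /= divr_ge0 //= ler_pdivrMr // mul1r ler_nat.
  - by rewrite -mulrBl -natr1 opprD addrA subrr add0r mulN1r normrN ger0_norm // invr_ge0 ltW.
apply: filterS nearP => n sep i j /step[i0 i1 ii] /step[j0 j1 jj] p q p01 q01.
exact: (sep (i%:R / n%:R, j%:R / n%:R)).
Qed.

(* The van Kampen obstruction to planarity, computed for the drawing of the graph with
   straight chords between points in convex position, is the coboundary of [f]: the
   chords of two independent edges cross with the parity prescribed by [f].  In a
   plane drawing [f a w] is the number of times, mod 2, that the arc [a] passes below
   the vertex [w]. *)
Definition van_kampen (V : eqType) (e lt : rel V) (f : V * V -> V -> bool) : Prop :=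
  forall a b, e a.1 a.2 -> e b.1 b.2 ->
    [/\ a.1 != b.1, a.1 != b.2, a.2 != b.1 & a.2 != b.2] ->
  crossing lt a b = f a b.1 (+) f a b.2 (+) (f b a.1 (+) f b a.2).

Definition tournament (V : eqType) (lt : rel V) : Prop :=
  forall s t, s != t -> lt t s = ~~ lt s t.

(** Crossings do not depend on the direction of the chords, so [g] may be read on the increasing
    direction of each edge; the two samplings of an arc need not be compared. *)
Lemma van_kampen_symmetrize (V : eqType) (e lt : rel V) (g : V * V -> V -> bool) :
    symmetric e -> tournament lt -> van_kampen e lt g ->
  exists2 f, (forall u v w, f (u, v) w = f (v, u) w) & van_kampen e lt f.
Proof.
move=> e_sym lt_t vk.
pose up (a : V * V) := if lt a.1 a.2 then a else (a.2, a.1).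
exists (fun a => g (up a)) => [u v w|a b ea eb [n1 n2 n3 n4]].
  rewrite /up /=; have [->//|/lt_t ->] := eqVneq u v.
  by case: (lt u v).
have up_id (c : V * V) : up c = c \/ up c = (c.2, c.1) by rewrite /up; case: ifP; [left|right].
have ea' : e a.2 a.1 by rewrite e_sym.
have eb' : e b.2 b.1 by rewrite e_sym.
case: (up_id a) => ->; case: (up_id b) => ->.
- exact: vk.
- have -> : crossing lt a b = crossing lt a (b.2, b.1) by rewrite /crossing /=; xor_tauto.
  by rewrite vk //=; xor_tauto.
- have -> : crossing lt a b = crossing lt (a.2, a.1) b by rewrite /crossing /=; xor_tauto.
  by rewrite vk //=; xor_tauto.
- have -> : crossing lt a b = crossing lt (a.2, a.1) (b.2, b.1) by rewrite /crossing /=; xor_tauto.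
  by rewrite vk //=; xor_tauto.
Qed.

Lemma chain_boundary_path (T : Type) (g : nat -> T) n :
  chain_boundary [seq (g i, g i.+1) | i <- iota 0 n] (g 0%N) (g n).
Proof.
move=> h; elim: n => [|n IHn]; first by rewrite big_nil addbb.
rewrite -addn1 iotaD map_cat big_cat IHn big_seq1 /= add0n addn1; xor_tauto.
Qed.

(** Points with different ordinates collide only for one value of [r], the quotient inside [q]; one
    plus the sum of all absolute values exceeds each of them. *)
Lemma generic_shear (R : realFieldType) (pts : seq (R * R)) :
  exists r : R, {in pts &, injective (fun z => z.1 + r * z.2)}.
Proof.
pose q (s t : R * R) := `|(s.1 - t.1) / (t.2 - s.2)|.
pose r := 1 + \sum_(s <- pts) \sum_(t <- pts) q s t.
exists r => s t sp tp st; apply/eqP; apply: contraT => /eqP nst; exfalso.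
have lt_r : q s t < r.
  have le1 : q s t <= \sum_(t <- pts) q s t.
    by rewrite (big_rem t) //= lerDl sumr_ge0 // => ? _; exact: normr_ge0.
  have le2 : \sum_(t <- pts) q s t <= \sum_(s <- pts) \sum_(t <- pts) q s t.
    rewrite [leRHS](big_rem s) //= lerDl sumr_ge0 // => ? _; apply: sumr_ge0 => ? _.
    exact: normr_ge0.
  by rewrite /r; lra.
have [e2|n2] := eqVneq s.2 t.2.
  by apply: nst; rewrite (surjective_pairing s) (surjective_pairing t) e2;
    congr pair; move: st; rewrite e2; lra.
have n2' : t.2 - s.2 != 0 by rewrite subr_eq0 eq_sym.
have re : r = (s.1 - t.1) / (t.2 - s.2).
  by apply: (mulIf n2'); rewrite divfK //; lra.
by move: lt_r; rewrite /q -re ltNge ler_norm.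
Qed.

(* Vertex-disjoint edges are drawn as disjoint compact arcs, so fine enough inscribed
   polygons of these arcs are still disjoint; a shear makes the abscissas of all the
   sample points distinct. *)
Lemma planar_van_kampen (R : realType) (V : finType) (e : rel V) :
    symmetric e -> planar R e ->
  exists lt f, [/\ tournament lt, forall u v w, f (u, v) w = f (v, u) w & van_kampen e lt f].
Proof.
move=> e_sym [p [c [p_inj c_arc c_vertex c_cross]]].
pose indep (q : V * V * (V * V)) := [/\ e q.1.1 q.1.2, e q.2.1 q.2.2 &
  [/\ q.1.1 != q.2.1, q.1.1 != q.2.2, q.1.2 != q.2.1 & q.1.2 != q.2.2]].
have c_disj q : indep q -> forall s t, s \in `[0, 1] -> t \in `[0, 1] ->
    c q.1.1 q.1.2 s <> c q.2.1 q.2.2 t.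
  case: q => -[u v] [w x] [/= euv ewx [uw ux vw vx]] s t s01 t01.
  have neq : [set u; v]%SET != [set w; x]%SET.
    apply/eqP => /setP/(_ u); rewrite !inE eqxx /= => /esym/orP[]; exact/negP.
  have [_ _ c0 c1 _] := c_arc u v euv; have [_ _ d0 d1 _] := c_arc w x ewx.
  have endpoint (r : R) : r \in `[0, 1] -> r \notin `]0, 1[ -> r = 0 \/ r = 1.
    rewrite !in_itv /= => /andP[r0 r1]; rewrite !lt_neqAle r0 r1 !andbT negb_and !negbK.
    by case/orP => /eqP ->; [left|right].
  have [si|so] := boolP (s \in `]0, 1[); first exact: c_cross.
  have [ti|to] := boolP (t \in `]0, 1[).
    by move=> /esym; apply: c_cross => //; rewrite eq_sym.
  by case: (endpoint s s01 so) => ->; case: (endpoint t t01 to) => ->;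
    rewrite ?c0 ?c1 ?d0 ?d1 => /p_inj/eqP; apply/negP.
have near_disj : \forall n \near \oo%classic, forall q, indep q ->
    forall i j, (i < n)%N -> (j < n)%N ->
    disjoint_segments (c q.1.1 q.1.2 (i%:R / n%:R), c q.1.1 q.1.2 (i.+1%:R / n%:R))
                      (c q.2.1 q.2.2 (j%:R / n%:R), c q.2.1 q.2.2 (j.+1%:R / n%:R)).
  apply: filter_forall => q.
  have [iq|niq] := pselect (indep q); last by apply: nearW => n /niq.
  case: (iq) => /c_arc[cc _ _ _ _] /c_arc[cd _ _ _ _] _.
  by apply: filterS (near_disjoint_segments cc cd (c_disj q iq)) => n + _.
have [n [n0 disj]] := filter_ex (filterI (nbhs_infty_gt 0) near_disj).
pose smp u v i := c u v (i%:R / n%:R).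
(* The vertices are added explicitly because [lt] must also compare isolated vertices, which are the
   end of no sampled arc. *)
pose pts := [seq smp a.1 a.2 i | a <- enum {: V * V}, i <- iota 0 n.+1] ++ [seq p v | v <- enum V].
have [r r_inj] := generic_shear pts.
pose L (z : R * R) := (z.1 + r * z.2, z.2).
have L_inj : injective L.
  by move=> [z1 z2] [w1 w2] [] /[swap] -> /addIr ->.
have p_pts v : p v \in pts by rewrite mem_cat map_f ?mem_enum ?orbT.
have smp_pts u v i : (i <= n)%N -> smp u v i \in pts.
  move=> le_in; rewrite mem_cat; apply/orP; left; apply/allpairsP.
  by exists ((u, v), i); rewrite mem_enum mem_iota.
pose Z (a : V * V) := [seq (L (smp a.1 a.2 i), L (smp a.1 a.2 i.+1)) | i <- iota 0 n].
pose lt : rel V := fun u v => lt_fst (L (p u)) (L (p v)).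
pose g a w := chain_sum (@below R) (Z a) (L (p w)).
have lt_t : tournament lt.
  move=> s t st; rewrite /lt /lt_fst -leNgt le_eqVlt; case: eqP => // /r_inj h.
  by rewrite (p_inj _ _ (h (p_pts _) (p_pts _))) eqxx in st.
suff vk : van_kampen e lt g.
  by have [f f_sym vkf] := van_kampen_symmetrize e_sym lt_t vk; exists lt, f.
move=> a b ea eb dab; have iab : indep (a, b) by [].
have bd u v : e u v -> chain_boundary (Z (u, v)) (L (p u)) (L (p v)).
  move=> /c_arc[_ _ c0 c1 _].
  have := @chain_boundary_path _ (fun i => L (smp u v i)) n.
  by rewrite /smp mul0r c0 divff ?pnatr_eq0 -?lt0n // c1.
have bda := bd _ _ ea; have bdb := bd _ _ eb; rewrite -!surjective_pairing in bda bdb.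
apply: (chain_crossing bda bdb) => _ _ /mapP[i + ->] /mapP[j + ->].
rewrite !mem_iota !add0n => /andP[_ lt_in] /andP[_ lt_jn].
have dij := disj _ iab i j lt_in lt_jn.
have neq k l : (k <= n)%N -> (l <= n)%N -> (L (smp a.1 a.2 k)).1 != (L (smp b.1 b.2 l)).1.
  move=> kn ln; apply/eqP => /r_inj h; apply: (c_disj _ iab (k%:R / n%:R) (l%:R / n%:R)).
  - by rewrite in_itv /= divr_ge0 //= ler_pdivrMr ?ltr0n // mul1r ler_nat.
  - by rewrite in_itv /= divr_ge0 //= ler_pdivrMr ?ltr0n // mul1r ler_nat.
  - by apply: h; exact: smp_pts.
apply: crossing_below => /=.
- by move/r_inj => -> //; apply: smp_pts; rewrite // ltnW.
- by move/r_inj => -> //; apply: smp_pts; rewrite // ltnW.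
- by split; apply: neq => //; exact: ltnW.
have LE s (k : R) : segment_point (L s.1, L s.2) k = L (segment_point s k).
  by congr pair; rewrite /=; ring.
move=> k l k01 l01; rewrite (LE (_, _)) (LE (_, _)) => /L_inj.
exact: dij.
Qed.

(** * Kasteleyn orientations *)

(** Interchanging [s] and [t] in the order flips the crossing of every edge at [s] with every
    independent edge at [t]. Where the orders disagree, exactly one of [h s t] and [h t s] is true,
    so adding [h] to [f] accounts for each flip once. *)
Lemma van_kampen_change_tournament (V : eqType) (e lt lt' : rel V) (f : V * V -> V -> bool) :
    tournament lt -> tournament lt' -> (forall u v w, f (u, v) w = f (v, u) w) ->
    van_kampen e lt f ->
  exists2 f', (forall u v w, f' (u, v) w = f' (v, u) w) & van_kampen e lt' f'.
Proof.
move=> lt_t lt'_t f_sym vk.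
pose h s t := (lt s t (+) lt' s t) && lt s t.
exists (fun a w => f a w (+) h a.1 w (+) h a.2 w) => [u v w|a b ea eb dab].
  by rewrite f_sym /=; xor_tauto.
have hh s t : s != t -> h t s = (lt s t (+) lt' s t) (+) h s t.
  by move=> st; rewrite /h (lt_t _ _ st) (lt'_t _ _ st); case: (lt s t); case: (lt' s t).
have := vk a b ea eb dab; case: dab => n1 n2 n3 n4.
rewrite (hh _ _ n1) (hh _ _ n2) (hh _ _ n3) (hh _ _ n4) /crossing => e1.
transitivity (crossing lt a b (+) (lt a.1 b.1 (+) lt' a.1 b.1) (+) (lt a.1 b.2 (+) lt' a.1 b.2) (+)
  (lt a.2 b.1 (+) lt' a.2 b.1) (+) (lt a.2 b.2 (+) lt' a.2 b.2)).
  by rewrite /crossing; xor_tauto.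
by rewrite /crossing e1; xor_tauto.
Qed.

Lemma van_kampen_inj (V W : eqType) (h : W -> V) (e lt : rel V) (f : V * V -> V -> bool) :
    injective h -> van_kampen e lt f ->
  van_kampen (relpre h e) (relpre h lt) (fun a w => f (h a.1, h a.2) (h w)).
Proof.
move=> h_inj vk a b ea eb [n1 n2 n3 n4].
have := vk (h a.1, h a.2) (h b.1, h b.2) ea eb.
by apply; split; rewrite (inj_eq h_inj).
Qed.

Section KasteleynMatrix.
Variables (R : comNzRingType) (m : nat) (e : rel 'I_m.*2).
Variable f : 'I_m.*2 * 'I_m.*2 -> 'I_m.*2 -> bool.

(* The product over a perfect matching of the signs [kasteleyn_flip] is the parity of
   the number of crossing pairs of chords in the matching, because the matching covers
   every vertex. *)
Definition kasteleyn_flip (a : 'I_m.*2 * 'I_m.*2) : bool :=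
  \big[addb/false]_(k | (k != a.1) && (k != a.2)) f a k.

Definition kasteleyn_mx : 'M[R]_m.*2 :=
  \matrix_(i, j) if e i j then (-1) ^+ ((j < i)%N (+) kasteleyn_flip (i, j)) else 0.

Lemma kasteleyn_sign (s : 'S_m.*2) :
    van_kampen e (fun i j => (j < i)%N) f -> (forall i, e (s (evn i)) (s (odn i))) ->
  (-1) ^+ s * \prod_(i < m) kasteleyn_mx (s (evn i)) (s (odn i)) = 1.
Proof.
move=> vk es; pose a i := (s (evn i), s (odn i)).
under eq_bigr do rewrite mxE es.
rewrite -signr_big_addb -signr_addb.
suff -> : odd_perm s = \big[addb/false]_(i < m)
    ((s (odn i) < s (evn i))%N (+) kasteleyn_flip (s (evn i), s (odn i))).
  by rewrite addbb.
pose G i i' := f (a i) (s (evn i')) (+) f (a i) (s (odn i')).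
(* Since [s] lists all the vertices, those outside a pair are the ends of the other pairs. *)
have flipE i : kasteleyn_flip (a i) = \big[addb/false]_(i' | i' != i) G i i'.
  rewrite /kasteleyn_flip (reindex_inj (@perm_inj _ s)) big_mkcond big_ord_double.
  rewrite [RHS]big_mkcond; apply: eq_bigr => i' _.
  rewrite !(inj_eq perm_inj) -!val_eqE /=.
  have [->|ii'] := eqVneq i' i; first by rewrite !eqxx /= andbF.
  by rewrite -val_eqE /= in ii'; rewrite !ifT //; lia.
have double2 (F : 'I_m.*2 -> 'I_m.*2 -> bool) :
    \big[addb/false]_j \big[addb/false]_k F j k =
    \big[addb/false]_(i < m) \big[addb/false]_(i' < m)
      ((F (evn i) (evn i') (+) F (evn i) (odn i')) (+) (F (odn i) (evn i') (+) F (odn i) (odn i'))).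
  rewrite big_ord_double; apply: eq_bigr => i _.
  by rewrite big_split /=; congr (_ (+) _); exact: big_ord_double.
rewrite odd_perm_inversions double2 big_split /=.
have -> : \big[addb/false]_(i < m) kasteleyn_flip (s (evn i), s (odn i)) =
    \big[addb/false]_(i < m) \big[addb/false]_(i' < m) ((i < i')%N && crossing (fun k l : 'I_m.*2 => (l < k)%N) (a i) (a i')).
  transitivity (\big[addb/false]_(i < m) (\big[addb/false]_(i' < m) ((i < i')%N && G i i') (+)
      \big[addb/false]_(i' < m) ((i' < i)%N && G i i'))).
    apply: eq_bigr => i _; rewrite flipE -big_split big_mkcond /=.
    apply: eq_bigr => i' _; rewrite -val_eqE /=.
    by case: (ltngtP i i'); rewrite /= ?addbF.
  rewrite big_split /= [X in _ (+) X]exchange_big -big_split; apply: eq_bigr => i _.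
  rewrite -big_split; apply: eq_bigr => i' _ /=.
  case: (ltnP i i') => //= ii'; rewrite vk ?es //.
  by rewrite !(inj_eq perm_inj) -!val_eqE /=; split; lia.
rewrite -big_split; apply: eq_bigr => i _ /=.
rewrite (eq_bigr (fun i' : 'I_m => ((i' == i) && (s (odn i) < s (evn i))%N) (+)
  ((i < i')%N && crossing (fun k l : 'I_m.*2 => (l < k)%N) (a i) (a i')))).
  rewrite big_split /=; congr (_ (+) _).
  by rewrite (bigD1 i) //= eqxx big1 ?addbF // => i' /negbTE->.
move=> i' _.
(* The reversed order has the same crossings, and makes the four terms literally the inversions
   between the two pairs. *)
have -> : crossing (fun k l : 'I_m.*2 => (l < k)%N) (a i) (a i') =
  (s (evn i') < s (evn i))%N (+) (s (odn i') < s (evn i))%N (+)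
  (s (evn i') < s (odn i))%N (+) (s (odn i') < s (odn i))%N by [].
have [->|ii'] := eqVneq i' i.
  have ee : (odn i < evn i)%N = false by rewrite /=; lia.
  by rewrite ee /= !ltnn ltnSn /= !addbF.
have lt_ii : (i <= i')%N = (i < i')%N by rewrite leq_eqVlt val_eqE eq_sym (negbTE ii').
rewrite /= !ltnS ltn_double ltn_Sdouble leq_double lt_ii.
by case: (i < i')%N => //=; rewrite !addbA.
Qed.

Lemma pfsum_kasteleyn :
    van_kampen e (fun i j => (j < i)%N) f ->
  pfsum kasteleyn_mx = #|[set s : 'S_m.*2 | [forall i, e (s (evn i)) (s (odn i))]]%SET|%:R.
Proof.
move=> vk; rewrite -sum1_card natr_sum big_mkcond; apply: eq_bigr => s _; rewrite inE.
case: ifPn => [/forallP es|]; first exact: kasteleyn_sign.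
rewrite negb_forall => /existsP[i nes].
by rewrite (bigD1 i) //= mxE (negbTE nes) mul0r mulr0.
Qed.

Lemma tr_kasteleyn :
    symmetric e -> irreflexive e -> (forall u v w, f (u, v) w = f (v, u) w) ->
  kasteleyn_mx^T = - kasteleyn_mx.
Proof.
move=> e_sym e_irr f_sym; apply/matrixP => i j; rewrite !mxE e_sym.
case: ifP => [eij|]; last by rewrite oppr0.
have -> : kasteleyn_flip (j, i) = kasteleyn_flip (i, j).
  by rewrite /kasteleyn_flip; apply: eq_big => [k|k _]; [rewrite andbC|exact: f_sym].
have := ltngtP i j; case=> [_|_|/val_inj ij].
- by rewrite !signr_addb expr1 expr0 mulN1r mul1r.
- by rewrite !signr_addb expr1 expr0 mulN1r mul1r opprK.
- by rewrite ij e_irr in eij.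
Qed.

End KasteleynMatrix.

Definition std_edge m : rel 'I_m.*2 := fun i j => (i != j) && (i./2 == j./2).

(** The chords of the standard matching do not cross, so no flips are needed and the [pfsum] of
    [std_skew] is a count as well. *)
Lemma std_skew_kasteleyn (R : comNzRingType) m :
  std_skew R m = kasteleyn_mx R (@std_edge m) (fun _ _ => false).
Proof.
apply/matrixP => i j; rewrite !mxE /std_edge /kasteleyn_flip big1 //= addbF -val_eqE.
by case: (i./2 == j./2); rewrite ?andbF // andbT; case: ltngtP.
Qed.

Lemma van_kampen_std m : van_kampen (@std_edge m) (fun i j => (j < i)%N) (fun _ _ => false).
Proof.
move=> [i j] [k l]; rewrite /std_edge /crossing -!val_eqE /= => /andP[n1 /eqP h1] /andP[n2 /eqP h2].
move=> [m1 m2 m3 m4].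
have hik : (i./2 != k./2)%N by apply/eqP; lia.
have [ik|ki] := ltnP i k.
  have -> : (k < i)%N = false by lia.
  have -> : (l < i)%N = false by lia.
  have -> : (k < j)%N = false by lia.
  by have -> : (l < j)%N = false by lia.
have -> : (k < i)%N by lia.
have -> : (l < i)%N by lia.
have -> : (k < j)%N by lia.
by have -> : (l < j)%N by lia.
Qed.

(** * Listing perfect matchings by permutations *)

Lemma perfect_matching_edge (V : finType) (e : rel V) (M : {set {set V}}) (u v : V) :
  symmetric e -> perfect_matching e M -> [set u; v]%SET \in M -> u != v -> e u v.
Proof.
move=> e_sym /andP[/fintype.subsetP sub _] /sub /imsetP[[x y] /= exy /setP uv] nuv.
rewrite inE /= in exy.
have eu : (u == x) || (u == y) by have := uv u; rewrite !inE eqxx.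
have ev : (v == x) || (v == y) by have := uv v; rewrite !inE eqxx orbT.
case/orP: eu nuv => /eqP->; case/orP: ev => /eqP->; rewrite ?eqxx // => _.
by rewrite e_sym.
Qed.

Lemma perfect_matching_listing (V : finType) (e : rel V) (M : {set {set V}}) m (h : 'I_m.*2 -> V) :
    irreflexive e -> bijective h -> perfect_matching e M ->
  exists s : 'S_m.*2, forall i, [set h (s (evn i)); h (s (odn i))]%SET \in M.
Proof.
move=> e_irr [h' hK h'K] /andP[/fintype.subsetP sub partM].
have [/eqP covM trivM _] := and3P partM.
have pairM A : A \in M -> exists p : V * V, p.1 != p.2 /\ A = [set p.1; p.2]%SET.
  move=> /sub /imsetP[[x y] /=]; rewrite inE /= => exy ->; exists (x, y); split=> //=.
  by apply: contraTneq exy => ->; rewrite e_irr.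
have cardM : #|M| = m.
  have := finset.card_partition partM.
  rewrite cardsT (bij_eq_card (Bijective h'K hK)) card_ord.
  rewrite (eq_bigr (fun=> 2%N)) => [|A /pairM[p [np ->]]]; last by rewrite cards2 np.
  by rewrite sum_nat_const; lia.
pose A (k : 'I_m) := enum_val (cast_ord (esym cardM) k).
have AM k : A k \in M by exact: enum_valP.
have A_inj : injective A by move=> k l /enum_val_inj/cast_ord_inj.
have [p pP] := fin_all_exists (fun k => pairM _ (AM k)).
pose g (j : 'I_m.*2) := if odd j then (p (half_ord j)).2 else (p (half_ord j)).1.
have gA j : g j \in A (half_ord j).
  by have [_ ->] := pP (half_ord j); rewrite /g !inE; case: odd; rewrite eqxx ?orbT.
have g_inj : injective g.
  move=> j k jk; have half_jk : half_ord j = half_ord k.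
    apply: A_inj; apply/eqP; apply: contraT => nA.
    have := finset.trivIsetP trivM _ _ (AM _) (AM _) nA.
    by move/disjointFr/(_ (gA j)); rewrite jk gA.
  rewrite (evn_odn_half j) (evn_odn_half k) -half_jk.
  have := jk; rewrite /g -half_jk; have [np _] := pP (half_ord j).
  by case: odd; case: odd => // /esym/eqP; rewrite ?[_ == (p _).2]eq_sym ?(negbTE np) // eq_sym (negbTE np).
have gh_inj : injective (h' \o g) by apply: inj_comp => //; exact: can_inj h'K.
exists (perm gh_inj) => i; rewrite !permE /= !h'K /g /= odd_double /=.
by rewrite half_evn half_odn; have [_ <-] := pP i.
Qed.

(** The listed pairs cover all vertices, so every block of a matching meets one of them and hence
    equals it. *)
Lemma perfect_matching_uniq (V : finType) (e : rel V) (M M' : {set {set V}}) m (h : 'I_m.*2 -> V)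
    (s : 'S_m.*2) : bijective h -> perfect_matching e M -> perfect_matching e M' ->
  (forall i, [set h (s (evn i)); h (s (odn i))]%SET \in M) ->
  (forall i, [set h (s (evn i)); h (s (odn i))]%SET \in M') -> M = M'.
Proof.
move=> [h' hK h'K].
wlog suff sub : M M' / perfect_matching e M -> perfect_matching e M' ->
    (forall i, [set h (s (evn i)); h (s (odn i))]%SET \in M) ->
    (forall i, [set h (s (evn i)); h (s (odn i))]%SET \in M') -> M \subset M'.
  by move=> pM pM' sM sM'; apply/eqP; rewrite finset.eqEsubset !sub.
move=> /andP[_ /and3P[_ trivM M0]] _ sM sM'; apply/fintype.subsetP => A AM.
have [A0|[x xA]] := set_0Vmem A; first by rewrite -A0 AM in M0.
pose j := (s^-1)%g (h' x).
have xE : x = h (s j) by rewrite /j permKV h'K.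
have xB : x \in [set h (s (evn (half_ord j))); h (s (odn (half_ord j)))]%SET.
  by rewrite !inE xE [in h (s j)](evn_odn_half j); case: odd; rewrite eqxx ?orbT.
suff -> : A = [set h (s (evn (half_ord j))); h (s (odn (half_ord j)))]%SET by exact: sM'.
apply/eqP; apply: contraT => nA.
have := finset.trivIsetP trivM _ _ AM (sM (half_ord j)) nA.
by move/disjointFr/(_ xA); rewrite xB.
Qed.

Lemma std_edge_pair m (j k : 'I_m.*2) :
  std_edge j k -> [set j; k]%SET = [set evn (half_ord j); odn (half_ord j)]%SET.
Proof.
move=> /andP[jk /eqP hjk].
have h : half_ord k = half_ord j by apply: val_inj; rewrite /= hjk.
rewrite {1}(evn_odn_half j) {1}(evn_odn_half k) h.
have : odd j != odd k.
  by apply: contraNneq jk => o; rewrite (evn_odn_half j) (evn_odn_half k) h o.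
by case: (odd j); case: (odd k) => // _; rewrite finset.setUC.
Qed.

(** Fix one listing of each matching; preceding it by the permutations that preserve the standard
    pairs yields distinct listings of the same matching. The order 2 ^ m * m! of this group is never
    computed. *)
Lemma leq_num_perfect_matchings (V : finType) (e : rel V) m (h : 'I_m.*2 -> V) :
    symmetric e -> irreflexive e -> bijective h ->
  (num_perfect_matchings e * #|[set s : 'S_m.*2 | [forall i, std_edge (s (evn i)) (s (odn i))]]%SET|
   <= #|[set s : 'S_m.*2 | [forall i, e (h (s (evn i))) (h (s (odn i)))]]%SET|)%N.
Proof.
move=> e_sym e_irr h_bij; set S := [set s | _]%SET; set T := [set s | _]%SET.
pose PM := [set M | perfect_matching e M]%SET.
have listM (M : {set {set V}}) : exists s : 'S_m.*2, M \in PM ->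
    forall i, [set h (s (evn i)); h (s (odn i))]%SET \in M.
  have [|nMP] := boolP (M \in PM); last by exists 1%g.
  by rewrite inE => /(perfect_matching_listing e_irr h_bij)[s sP]; exists s.
have [t tP] := fin_all_exists listM.
pose F (q : {set {set V}} * 'S_m.*2) := (q.2 * t q.1)%g.
have FP M s : M \in PM -> s \in S -> forall i, [set h (F (M, s) (evn i)); h (F (M, s) (odn i))]%SET \in M.
  move=> MP; rewrite inE => /forallP sS i; rewrite /F /= !permM.
  have -> : [set h (t M (s (evn i))); h (t M (s (odn i)))]%SET =
            (h \o t M) @: [set s (evn i); s (odn i)]%SET by rewrite imsetU1 imset_set1.
  by rewrite (std_edge_pair (sS i)) imsetU1 imset_set1; exact: tP.
have h_inj := bij_inj h_bij.
rewrite /num_perfect_matchings -/PM -cardsX -(card_in_imset (f := F)); last first.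
  move=> [M s] [M' s']; rewrite !inE /= => /andP[MP sS] /andP[MP' sS'] e1.
  have MM' : M = M'.
    apply: (perfect_matching_uniq h_bij (e := e) (s := F (M, s))) => //.
    - by apply: FP; rewrite inE.
    - by rewrite e1; apply: FP; rewrite inE.
  by move: e1; rewrite /F MM' /= => /mulIg ->.
apply/subset_leq_card/fintype.subsetP => _ /imsetP[[M s] /= /setXP[/= MP sS] ->].
rewrite inE; apply/forallP => i.
apply: (@perfect_matching_edge _ e M) => //; first by rewrite inE in MP.
  exact: FP.
by rewrite (inj_eq h_inj) (inj_eq perm_inj) -val_eqE /=; lia.
Qed.

(** * Bounds from determinants of signed adjacency matrices *)

Lemma signed_adjacency_hadamard (C : numClosedFieldType) n (E b : rel 'I_n) d
    (A : 'M[C]_n := \matrix_(i, j) if E i j then (-1) ^+ b i j else 0) :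
  (forall i, #|[pred j | E i j]| = d) ->
  `|\det A| ^+ 2 <= d%:R ^+ n /\
  (`|\det A| ^+ 2 = d%:R ^+ n ->
   forall i j, i != j -> ~~ odd #|[pred k | E i k && E j k]|).
Proof.
move=> reg.
have HE i j : (A *m map_mx Num.conj A^T) i j =
    \sum_(k | E i k && E j k) (-1) ^+ (b i k (+) b j k).
  rewrite mxE [RHS]big_mkcond; apply: eq_bigr => k _; rewrite !mxE.
  case: (E i k); case: (E j k); rewrite /= ?mul0r ?conjC0 ?mulr0 //.
  by rewrite rmorph_sign signr_addb.
have [le_det eq_det] : `|\det A| ^+ 2 <= d%:R ^+ n /\
    (`|\det A| ^+ 2 = d%:R ^+ n -> A *m map_mx Num.conj A^T = d%:R%:M).
  apply: hadamard => i; rewrite HE (eq_bigl [pred k | E i k]) => [|k]; last by rewrite /= andbb.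
  by under eq_bigr do rewrite addbb expr0; rewrite sumr_const reg.
split=> // /eq_det H i j ij; move/matrixP/(_ i j): H.
rewrite HE !mxE (negbTE ij) mulr0n.
set P := [pred k | E i k && E j k].
(* A sum of signs is the number of its terms minus twice the number of negative ones; if it is zero,
   the number of terms is even. *)
have -> : \sum_(k | E i k && E j k) (-1) ^+ (b i k (+) b j k) =
    #|P|%:R - 2 * (\sum_(k in P) (b i k (+) b j k))%:R :> C.
  rewrite -sum1_card !natr_sum mulr_sumr -sumrB; apply: eq_bigr => k _.
  by case: (_ (+) _); rewrite /= ?expr1 ?expr0; ring.
move/eqP; rewrite subr_eq0 -natrM eqr_nat => /eqP->.
by rewrite mul2n odd_double.
Qed.

Lemma card_pred_bij (T T' : finType) (h : T -> T') (P : pred T') :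
  bijective h -> #|[pred x | P (h x)]| = #|[pred y | P y]|.
Proof.
move=> h_bij; rewrite -!sum1_card [RHS](reindex h); first exact: eq_bigl.
exact: onW_bij.
Qed.

Lemma expn_le_of_det (d m N : nat) (x : algC) :
  `|x| ^+ 2 <= d%:R ^+ m.*2 -> N%:R ^+ 2 <= `|x| -> (N ^ 2 <= d ^ m)%N.
Proof.
move=> le_x le_N; rewrite -(@leq_exp2r _ _ 2) // -[((_ ^ m) ^ 2)%N]expnM muln2.
rewrite -(ler_nat algC) !natrX; apply: le_trans le_x.
by rewrite ler_pXn2r // nnegrE exprn_ge0.
Qed.

Lemma pfaffian_bound (V : finType) (e : rel V) d m :
    symmetric e -> regular_graph e d -> pfaffian e -> #|V| = m.*2 ->
  (num_perfect_matchings e ^ 2 <= d ^ m)%N.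
Proof.
move=> e_sym reg [ori [[sub_o xor_o] detS]] cardV.
pose E : rel 'I_(#|V|) := fun i j => e (enum_val i) (enum_val j).
pose b : rel 'I_(#|V|) := fun i j => ~~ ori (enum_val i) (enum_val j).
pose S : 'M[algC]_(#|V|) := map_mx intr (skew_adjacency ori).
have SE : S =
    \matrix_(i, j) if E i j then (-1) ^+ b i j else 0.
  apply/matrixP => i j; rewrite !mxE /E /b.
  have := xor_o (enum_val i) (enum_val j); have := sub_o (enum_val i) (enum_val j).
  have := sub_o (enum_val j) (enum_val i); rewrite [e (enum_val j) _]e_sym.
  case: (ori (enum_val i) _) => [_ -> //|] /=.
  case: (ori (enum_val j) _) => [-> // _ _|_ _ ne] /=.
  by case: ifP => // /ne.
have [|le_det _] := @signed_adjacency_hadamard algC _ E b d.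
  move=> i; rewrite (card_pred_bij (e (enum_val i)) (@enum_val_bij V)) -(reg (enum_val i)).
  by rewrite cardsE.
apply: (@expn_le_of_det d m _ (\det S)); first by rewrite SE -cardV.
by rewrite /S det_map_mx detS /= -pmulrn natrX ger0_norm // exprn_ge0.
Qed.

(** The vertices are renumbered and [f] is adapted to the order of their numbers, on which the signs
    of [kasteleyn_mx] are based. Then K has nonnegative [pfsum], at least N times that of
    [std_skew], and squaring compares N ^ 2 with det K. *)
Lemma van_kampen_bound (V : finType) (e lt : rel V) (f : V * V -> V -> bool) d m :
    symmetric e -> irreflexive e -> regular_graph e d ->
    tournament lt -> (forall u v w, f (u, v) w = f (v, u) w) -> van_kampen e lt f ->
    #|V| = m.*2 ->
  (num_perfect_matchings e ^ 2 <= d ^ m)%N /\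
  ((num_perfect_matchings e ^ 2 = d ^ m)%N ->
   forall u v, u != v -> ~~ odd #|[set w | e u w && e v w]%SET|).
Proof.
move=> e_sym e_irr reg lt_t f_sym vk cardV.
pose h (i : 'I_m.*2) : V := enum_val (cast_ord (esym cardV) i).
have h_bij : bijective h.
  apply: bij_comp; first exact: enum_val_bij.
  by exists (cast_ord cardV); [exact: cast_ordKV|exact: cast_ordK].
have h_inj := bij_inj h_bij.
pose E : rel 'I_m.*2 := relpre h e.
have lt_t' : tournament (relpre h lt) by move=> i j ij; apply: lt_t; rewrite (inj_eq h_inj).
have gt_t : tournament (fun i j : 'I_m.*2 => (j < i)%N).
  by move=> i j; rewrite -val_eqE /= => ij; rewrite -leqNgt [RHS]leq_eqVlt (negbTE ij).
have [g g_sym vkg] := van_kampen_change_tournament lt_t' gt_t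
   (fun u v w => f_sym (h u) (h v) (h w)) (van_kampen_inj h_inj vk).
have E_sym : symmetric E by move=> i j; exact: e_sym.
have E_irr : irreflexive E by move=> i; exact: e_irr.
pose K : 'M[algC]_m.*2 := kasteleyn_mx _ E g.
have := sqr_pfsum (tr_kasteleyn algC E_sym E_irr g_sym).
rewrite (pfsum_kasteleyn algC vkg) std_skew_kasteleyn (pfsum_kasteleyn algC (@van_kampen_std m)).
have := leq_num_perfect_matchings e_sym e_irr h_bij.
rewrite -/K; set N := num_perfect_matchings e; set c := #|_|; set Q := #|_| => leNc eqK.
have c_gt0 : (0 < c)%N.
  apply/card_gt0P; exists 1%g; rewrite inE; apply/forallP => i.
  by rewrite !perm1 /std_edge /= doubleK uphalf_double eqxx andbT -val_eqE /=; lia.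
have leN : N%:R ^+ 2 <= `|\det K|.
  have c2 : (0 : algC) < c%:R ^+ 2 by rewrite exprn_gt0 // ltr0n.
  rewrite -(ler_pM2r c2) -exprMn -natrM -[X in _ * X]ger0_norm ?exprn_ge0 //.
  by rewrite -normrM -eqK ger0_norm ?exprn_ge0 // ler_pXn2r ?nnegrE ?ler0n // ler_nat.
pose b : rel 'I_m.*2 := fun i j => (j < i)%N (+) kasteleyn_flip g (i, j).
have [|le_det eq_det] := @signed_adjacency_hadamard algC _ E b d.
  by move=> i; rewrite (card_pred_bij (e (h i)) h_bij) -(reg (h i)) cardsE.
rewrite -[\matrix_(i, j) _]/K in le_det eq_det.
split=> [|numV]; first exact: expn_le_of_det le_det leN.
have detK : `|\det K| ^+ 2 = d%:R ^+ m.*2.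
  have dm : (d%:R : algC) ^+ m.*2 = (N%:R ^+ 2) ^+ 2.
    by rewrite -muln2 exprM -!natrX -numV.
  by apply/eqP; rewrite eq_le le_det dm ler_pXn2r ?nnegrE // exprn_ge0.
move=> u v uv; have [h' hK h'K] := h_bij.
have := eq_det detK (h' u) (h' v); rewrite (inj_eq (can_inj h'K)) => /(_ uv).
by rewrite /E /= !h'K (card_pred_bij [pred w | e u w && e v w] h_bij) cardsE.
Qed.

(** * Graphs with even codegrees *)

(* [F (u, v)] need not come from an edge: it may be the sum along a path replacing it,
   so this excludes subdivisions of K5. *)
Lemma van_kampen_K5 (V : eqType) (lt : rel V) (F : V * V -> V -> bool) (b0 b1 b2 b3 b4 : V) :
    tournament lt -> uniq [:: b0; b1; b2; b3; b4] ->
    (forall u v w x, all (mem [:: b0; b1; b2; b3; b4]) [:: u; v; w; x] -> uniq [:: u; v; w; x] ->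
      crossing lt (u, v) (w, x) = F (u, v) w (+) F (u, v) x (+) (F (w, x) u (+) F (w, x) v)) ->
  False.
Proof.
move=> lt_t; rewrite /= !inE !negb_or !andbT.
move=> /and4P[/and4P[n01 n02 n03 n04] /and3P[n12 n13 n14] /andP[n23 n24] n34] vk.
have sw (s t : V) : s != t -> (t == s) = false by rewrite eq_sym => /negbTE.
have nn2 := (sw _ _ n01, sw _ _ n02, sw _ _ n03, sw _ _ n04, sw _ _ n12, sw _ _ n13, sw _ _ n14,
  sw _ _ n23, sw _ _ n24, sw _ _ n34).
have nn1 := (negbTE n01, negbTE n02, negbTE n03, negbTE n04, negbTE n12, negbTE n13, negbTE n14,
  negbTE n23, negbTE n24, negbTE n34).
(* All 15 pairs of disjoint edges. In convex position each 4 of the 5 points give one crossing, so 5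
   in all; reversing one comparison changes 6 terms, so the parity is odd for any tournament. On the
   other side each value F a w occurs twice. *)
have : crossing lt (b0, b1) (b2, b3) (+) crossing lt (b0, b1) (b2, b4) (+)
       crossing lt (b0, b1) (b3, b4) (+) crossing lt (b0, b2) (b1, b3) (+)
       crossing lt (b0, b2) (b1, b4) (+) crossing lt (b0, b2) (b3, b4) (+)
       crossing lt (b0, b3) (b1, b2) (+) crossing lt (b0, b3) (b1, b4) (+)
       crossing lt (b0, b3) (b2, b4) (+) crossing lt (b0, b4) (b1, b2) (+)
       crossing lt (b0, b4) (b1, b3) (+) crossing lt (b0, b4) (b2, b3) (+)
       crossing lt (b1, b2) (b3, b4) (+) crossing lt (b1, b3) (b2, b4) (+)
       crossing lt (b1, b4) (b2, b3) = true.
  rewrite /crossing /= (lt_t _ _ n12) (lt_t _ _ n13) (lt_t _ _ n23) (lt_t _ _ n24) (lt_t _ _ n34).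
  rewrite ?(lt_t _ _ n14); xor_tauto.
rewrite !vk; try by rewrite /= !inE ?eqxx ?nn1 ?nn2 ?orbT.
by rewrite (_ : _ (+) _ = false) //; xor_tauto.
Qed.

(** The same parity count over the 18 pairs of disjoint edges: 9 of them cross when the two sides
    are consecutive on the polygon, while each value F a w occurs twice. *)
Lemma van_kampen_K33 (V : eqType) (lt : rel V) (F : V * V -> V -> bool) (a0 a1 a2 b0 b1 b2 : V) :
    tournament lt -> uniq [:: a0; a1; a2; b0; b1; b2] ->
    (forall u v w x, u \in [:: a0; a1; a2] -> v \in [:: b0; b1; b2] ->
      w \in [:: a0; a1; a2] -> x \in [:: b0; b1; b2] -> u != w -> v != x ->
      crossing lt (u, v) (w, x) = F (u, v) w (+) F (u, v) x (+) (F (w, x) u (+) F (w, x) v)) ->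
  False.
Proof.
move=> lt_t; rewrite /= !inE !negb_or !andbT.
move=> /and5P[/and5P[m01 m02 m03 m04 m05] /and4P[m12 m13 m14 m15] /and3P[m23 m24 m25]
  /andP[m34 m35] m45] vk.
have : crossing lt (a0, b0) (a1, b1) (+) crossing lt (a0, b0) (a1, b2) (+)
       crossing lt (a0, b1) (a1, b0) (+) crossing lt (a0, b1) (a1, b2) (+)
       crossing lt (a0, b2) (a1, b0) (+) crossing lt (a0, b2) (a1, b1) (+)
       crossing lt (a0, b0) (a2, b1) (+) crossing lt (a0, b0) (a2, b2) (+)
       crossing lt (a0, b1) (a2, b0) (+) crossing lt (a0, b1) (a2, b2) (+)
       crossing lt (a0, b2) (a2, b0) (+) crossing lt (a0, b2) (a2, b1) (+)
       crossing lt (a1, b0) (a2, b1) (+) crossing lt (a1, b0) (a2, b2) (+)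
       crossing lt (a1, b1) (a2, b0) (+) crossing lt (a1, b1) (a2, b2) (+)
       crossing lt (a1, b2) (a2, b0) (+) crossing lt (a1, b2) (a2, b1) = true.
  rewrite /crossing /= !(lt_t _ _ m13, lt_t _ _ m14, lt_t _ _ m15, lt_t _ _ m23, lt_t _ _ m24,
    lt_t _ _ m25, lt_t _ _ m34, lt_t _ _ m35, lt_t _ _ m45); xor_tauto.
rewrite !vk ?inE ?eqxx ?orbT //; try by rewrite eq_sym.
by rewrite (_ : _ (+) _ = false) //; xor_tauto.
Qed.

Section EvenCodegree.
Variables (V : finType) (e lt : rel V) (f : V * V -> V -> bool).
Hypotheses (e_sym : symmetric e) (e_irr : irreflexive e) (e_reg : regular_graph e 4).
Hypotheses (lt_t : tournament lt) (vk : van_kampen e lt f).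
Hypothesis codeg_even : forall u v, u != v -> ~~ odd #|[set w | e u w && e v w]%SET|.

Let N v := [set w | e v w]%SET.

Lemma chain_boundary1 (T : Type) (u v : T) : chain_boundary [:: (u, v)] u v.
Proof. by move=> h; rewrite big_seq1. Qed.

Lemma chain_boundary2 (T : Type) (u x v : T) : chain_boundary [:: (u, x); (x, v)] u v.
Proof. by move=> h; rewrite big_cons big_seq1 /=; xor_tauto. Qed.

(* Without a twin, any two nonadjacent neighbours [a], [b] of [v] have a common
   neighbour whose only neighbours in [N v] are [a] and [b]; these vertices complete
   [v] and [N v] to a subdivision of K5. *)
Lemma twin_exists v : exists2 v', v' != v & N v' = N v.
Proof.
apply: contrapT => no_twin.
have codegN x y : x != y -> ~~ odd #|N x :&: N y|%SET.
  move=> xy; have := codeg_even xy; congr (~~ odd _); apply: eq_card => w.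
  by rewrite !inE.
(* The codegree is even and less than 4, as codegree 4 would make [x] a twin of [v]. *)
have cardI x : x != v -> #|N x :&: N v|%SET = 0%N \/ #|N x :&: N v|%SET = 2%N.
  move=> xv; have := codegN x v xv.
  have : (#|N x :&: N v|%SET < 4)%N.
    rewrite -(e_reg v); apply: proper_card; rewrite finset.properEneq finset.subsetIr andbT.
    apply/negP => /eqP NI; apply: no_twin; exists x => //.
    apply/eqP; rewrite eq_sym finset.eqEcard (e_reg x) (e_reg v) leqnn andbT.
    exact/finset.setIidPr.
  by case: #|_| => [|[|[|[|]]]] //; [left|right].
have vN x : x \in N v -> x != v by apply: contraTneq => ->; rewrite inE e_irr.
have card_rest a b : a \in N v -> b \in N v -> a != b -> #|N v :\: [set a; b]|%SET = 2%N.
  move=> aN bN ab.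
  rewrite finset.cardsD (e_reg v) (_ : N v :&: _ = [set a; b])%SET ?cards2 ?ab //.
  apply/finset.setIidPr/fintype.subsetP => z; rewrite !inE in aN bN *.
  by case/orP => /eqP->.
have out a b y : a \in N v -> b \in N v -> a != b -> ~~ e a b -> y \in N v -> e a y ->
    N a :&: N v = N v :\: [set a; b]%SET.
  move=> aN bN ab nab yN ay; apply/eqP; rewrite finset.eqEcard; apply/andP; split.
    apply/fintype.subsetP => z; rewrite !inE => /andP[az ->]; rewrite andbT negb_or.
    by apply/andP; split; apply: contraTneq az => ->; rewrite ?e_irr.
  rewrite card_rest //; case: (cardI a (vN a aN)) => [/eqP|-> //].
  rewrite cards_eq0 => /eqP/setP/(_ y).
  by rewrite !inE ay; rewrite inE in yN; rewrite yN.
have mid a b : a \in N v -> b \in N v -> a != b -> ~~ e a b ->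
    exists x, [&& x \notin N v, x != v, e a x, e b x & N x :&: N v == [set a; b]]%SET.
  move=> aN bN ab nab.
  suff [x /and4P[xN xv ax bx]] : exists x, [&& x \notin N v, x != v, e a x & e b x].
    exists x; rewrite xN xv ax bx /= eq_sym finset.eqEcard cards2 ab.
    have sub : ([set a; b] \subset N x :&: N v)%SET.
      by apply/fintype.subsetP => y; rewrite !inE in aN bN *; case/orP => /eqP->;
        rewrite [e x _]e_sym ?ax ?bx.
    by rewrite sub; case: (cardI x xv) => -> //.
  (* Besides [v], the vertices [a] and [b] have an odd number of common neighbours. If all lie in
     [N v], then by [out] they are the two vertices of [N v] other than [a] and [b], an even
     number. *)
  apply/existsP; apply: contraT; rewrite negb_exists => /forallP no_x.
  have ba : b != a by rewrite eq_sym.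
  have nba : ~~ e b a by rewrite e_sym.
  have := codegN a b ab; rewrite (cardsD1 v) !inE ![e _ v]e_sym.
  have [av bv] : e v a /\ e v b by rewrite !inE in aN bN.
  rewrite av bv /= => odd_rest.
  have [y] : exists y, y \in (N a :&: N b :\ v)%SET.
    by apply/set0Pn; apply: contraNneq odd_rest => ->; rewrite cards0.
  rewrite !inE => /and3P[yv ay by_].
  have yN : y \in N v by have := no_x y; rewrite ay by_ yv !andbT negbK.
  move: odd_rest; have -> : (N a :&: N b :\ v = N v :\: [set a; b])%SET.
    apply/setP => z; have/setP/(_ z) := out a b y aN bN ab nab yN ay.
    have/setP/(_ z) := out b a y bN aN ba nba yN by_.
    rewrite !inE; have := no_x z; rewrite inE.
    have [->|zv] := eqVneq z v; first by rewrite e_irr !andbF.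
    by case: (e v z); case: (e a z); case: (e b z); case: (z == a); case: (z == b).
  by rewrite card_rest.
pose md a b := odflt a [pick x | [&& x \notin N v, x != v, e a x, e b x & N x :&: N v == [set a; b]]]%SET.
have mdP a b : a \in N v -> b \in N v -> a != b -> ~~ e a b ->
    [&& md a b \notin N v, md a b != v, e a (md a b), e b (md a b) &
        N (md a b) :&: N v == [set a; b]]%SET.
  move=> aN bN ab nab; rewrite /md; case: pickP => [x //|none].
  by have [x] := mid a b aN bN ab nab; rewrite none.
pose Z u w := if e u w then [:: (u, w)] else [:: (u, md u w); (md u w, w)].
pose S := v :: enum (N v).
have memS u : (u \in S) = (u == v) || e v u by rewrite inE mem_enum inE.
have nbrS u w : u \in S -> w \in S -> u != w -> ~~ e u w -> u \in N v /\ w \in N v.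
  rewrite !memS !inE => /orP[/eqP->|vu] /orP[/eqP->|vw]; rewrite ?eqxx //.
  - by rewrite vw.
  - by rewrite e_sym vu.
(* A middle vertex determines the pair it serves, as its trace on [N v]; hence paths for disjoint
   pairs share no vertex. *)
pose near_pair u w y := [\/ y = u, y = w | y \notin S /\ N y :&: N v = [set u; w]%SET].
have ZP u w a : u \in S -> w \in S -> u != w -> a \in Z u w ->
    [/\ e a.1 a.2, near_pair u w a.1 & near_pair u w a.2].
  move=> uS wS uw; rewrite /Z; case: ifPn => [euw|nuw].
    by rewrite inE => /eqP->; split=> //; [constructor 1|constructor 2].
  have [uN wN] := nbrS u w uS wS uw nuw.
  have /and5P[mN mv um wm /eqP mI] := mdP u w uN wN uw nuw.
  have mS : md u w \notin S by rewrite memS negb_or mv; rewrite inE in mN.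
  rewrite !inE => /orP[]/eqP->; split=> //=; rewrite 1?e_sym //.
  - by constructor 1.
  - by constructor 3.
  - by constructor 3.
  - by constructor 2.
have near_disj u w x z s t : uniq [:: u; w; x; z] -> u \in S -> w \in S -> x \in S -> z \in S ->
    near_pair u w s -> near_pair x z t -> s != t.
  rewrite /= !inE !negb_or !andbT => /and3P[/and3P[uw ux uz] /andP[wx wz] xz] uS wS xS zS.
  case=> [->|->|[sS sI]]; case=> [->|->|[tS tI]] //; try by apply: contraNneq tS => <-.
  - by apply: contraNneq sS => ->.
  - by apply: contraNneq sS => ->.
  - apply: contraTneq ux => st; move: sI; rewrite st tI => /setP/(_ u).
    by rewrite !inE eqxx (negbTE uz) orbF negbK.
have [b1 [b2 [b3 [b4 Sb]]]] : exists b1 b2 b3 b4, S = [:: v; b1; b2; b3; b4].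
  rewrite /S; have := e_reg v; rewrite -/(N v) cardE.
  by case: (enum (N v)) => [|b1 [|b2 [|b3 [|b4 []]]]] // _; exists b1, b2, b3, b4.
have uniqS : uniq S by rewrite /S /= enum_uniq mem_enum inE e_irr.
apply: (@van_kampen_K5 V lt (fun a => chain_sum f (Z a.1 a.2)) v b1 b2 b3 b4) => //.
  by rewrite -Sb.
move=> u w x z; rewrite -Sb => /and5P[uS wS xS zS _] uq.
have [uw xz] : u != w /\ x != z.
  by move: uq; rewrite /= !inE !negb_or => /and4P[/and3P[-> _ _] _ -> _].
have bdZ s t : chain_boundary (Z s t) s t.
  by rewrite /Z; case: ifP => _; [exact: chain_boundary1|exact: chain_boundary2].
apply: chain_crossing => // a b aZ bZ.
have [ea a1 a2] := ZP u w a uS wS uw aZ; have [eb b1' b2'] := ZP x z b xS zS xz bZ.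
by apply: vk => //; split; exact: (near_disj u w x z).
Qed.

Definition twin v := odflt v [pick x | (x != v) && (N x == N v)].

Lemma twinP v : twin v != v /\ N (twin v) = N v.
Proof.
rewrite /twin; case: pickP => [x /andP[xv /eqP xN] //|none].
by have [x xv xN] := twin_exists v; have := none x; rewrite xv xN eqxx.
Qed.

Lemma e_twinl u w : e (twin u) w = e u w.
Proof. by have [_ /setP/(_ w)] := twinP u; rewrite !inE. Qed.

Lemma e_twinr u w : e u (twin w) = e u w.
Proof. by rewrite e_sym e_twinl e_sym. Qed.

(** Three vertices with equal neighbourhoods form a K33 with three of their common neighbours. *)
Lemma no_three_twins u w x : uniq [:: u; w; x] -> N u = N w -> N u = N x -> False.
Proof.
move=> uq Nuw Nux.
have [p [q [r [uqB sB]]]] : exists p q r, uniq [:: p; q; r] /\ {subset [:: p; q; r] <= N u}.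
  have := e_reg u; rewrite -/(N u) cardE; have := enum_uniq (N u); have := mem_enum (N u).
  case: (enum (N u)) => [|p [|q [|r [|z []]]]] // mE uE _; exists p, q, r.
  split; first by move: uE; rewrite /= !inE !negb_or => /and4P[/and3P[-> -> _] /andP[-> _] _ _].
  by move=> y; rewrite -mE !inE => /or3P[]/eqP->; rewrite eqxx ?orbT.
have eAB y z : y \in [:: u; w; x] -> z \in [:: p; q; r] -> e y z.
  move=> yA /sB; rewrite inE; move: yA; rewrite !inE => /or3P[]/eqP->//.
    by have/setP/(_ z) := Nuw; rewrite !inE => ->.
  by have/setP/(_ z) := Nux; rewrite !inE => ->.
have neqAB y z : y \in [:: u; w; x] -> z \in [:: p; q; r] -> y != z.
  by move=> yA zB; apply: contraTneq (eAB y z yA zB) => ->; rewrite e_irr.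
apply: (@van_kampen_K33 V lt f u w x p q r) => // [|y z y' z' yA zB yA' zB' yy' zz'].
  rewrite -[[:: u; w; x; p; q; r]]/([:: u; w; x] ++ [:: p; q; r]) cat_uniq uq uqB andbT andTb.
  by apply/negP => /hasP[z zB zA]; have := neqAB z z zA zB; rewrite eqxx.
apply: vk; rewrite ?eAB //; split=> //=; [exact: neqAB|rewrite eq_sym; exact: neqAB].
Qed.

Lemma twin_uniq v x : x != v -> N x = N v -> x = twin v.
Proof.
have [tv tN] := twinP v; move=> xv xN; apply/eqP; apply: contraT => xt; exfalso.
apply: (@no_three_twins v (twin v) x) => //.
by rewrite /= !inE negb_or [v == twin v]eq_sym [v == x]eq_sym tv xv eq_sym xt.
Qed.

Lemma twinK : involutive twin.
Proof.
move=> v; have [tv tN] := twinP v; apply/esym/twin_uniq; last exact: esym.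
by rewrite eq_sym.
Qed.

Lemma twin_neq v : twin v != v. Proof. by have [] := twinP v. Qed.

Lemma twin_pairs_uniq p q : p != q -> q != twin p -> uniq [:: p; twin p; q; twin q].
Proof.
move=> pq qtp.
have pt : p != twin p by rewrite eq_sym twin_neq.
have qt : q != twin q by rewrite eq_sym twin_neq.
have ptq : p != twin q by rewrite -(inj_eq (inv_inj twinK)) twinK eq_sym.
have tpq : twin p != q by rewrite eq_sym.
have tptq : twin p != twin q by rewrite (inj_eq (inv_inj twinK)).
by rewrite /= !inE !negb_or pt pq ptq tpq tptq qt.
Qed.

(** Neighbourhoods are closed under [twin], so two different twin pairs already fill the four
    places. *)
Lemma nbrE s p q : e s p -> e s q -> p != q -> q != twin p ->
  forall t, e s t = (t \in [:: p; twin p; q; twin q]).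
Proof.
move=> sp sq pq qtp t; have uq := twin_pairs_uniq pq qtp.
have sub : [set x in [:: p; twin p; q; twin q]]%SET \subset N s.
  by apply/fintype.subsetP => x; rewrite !inE => /or4P[]/eqP->; rewrite ?e_twinr.
have : ([set x in [:: p; twin p; q; twin q]] == N s)%SET.
  by rewrite finset.eqEcard sub (e_reg s) cardsE (card_uniqP uq).
by move=> /eqP/setP/(_ t); rewrite inE => ->; rewrite inE.
Qed.

Lemma nbr_exists s p : exists2 q, e s q & (q != p) && (q != twin p).
Proof.
apply: contrapT => no_q.
have sub : N s \subset [set p; twin p]%SET.
  apply/fintype.subsetP => q; rewrite !inE => sq; apply: contraT => nq; exfalso.
  by apply: no_q; exists q; rewrite // -negb_or.
have := subset_leq_card sub; rewrite (e_reg s) cards2.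
by case: (_ != _).
Qed.

Lemma xor_pred1 (x : V) (g : V -> bool) : \big[addb/false]_t ((t == x) && g t) = g x.
Proof. by rewrite (bigD1 x) //= eqxx big1 ?addbF // => t /negbTE->. Qed.

Lemma addb_mem_uniq (r : seq V) (g : V -> bool) :
  uniq r -> \big[addb/false]_t ((t \in r) && g t) = \big[addb/false]_(x <- r) g x.
Proof.
elim: r => [|x r IHr] /= => [_|/andP[xr uq]]; first by rewrite big_nil big1.
rewrite big_cons -IHr // -(xor_pred1 x g) -big_split; apply: eq_bigr => t _ /=.
rewrite inE; have [->|_] := eqVneq t x; last by rewrite addFb.
by rewrite (negbTE xr) addbF.
Qed.

(** Handshaking: summed over the edges inside [U], each [h s] occurs as often as the degree of [s]
    in [U], which is odd only at [y] and [c]. Comparing ranks keeps one direction of each edge. *)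
Lemma chain_boundary_subgraph (U : pred V) y c :
    U y -> U c -> y != c ->
    (forall s, U s -> \big[addb/false]_t (U t && e s t) = (s == y) (+) (s == c)) ->
  chain_boundary
    [seq p <- enum {: V * V} | [&& U p.1, U p.2, e p.1 p.2 & (enum_rank p.1 < enum_rank p.2)%N]] y c.
Proof.
move=> Uy Uc yc degU h; pose P s t := [&& U s, U t & e s t].
have P_sym s t : P s t = P t s by rewrite /P e_sym; case: (U s); case: (U t).
transitivity (\big[addb/false]_s (U s && (h s && ((s == y) (+) (s == c))))); last first.
  transitivity (\big[addb/false]_s (((s == y) && (U s && h s)) (+) ((s == c) && (U s && h s)))).
    by apply: eq_bigr => s _; case: (U s); case: (h s); case: (s == y); case: (s == c).
  by rewrite big_split /= !xor_pred1 Uy Uc.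
transitivity (\big[addb/false]_s \big[addb/false]_t (P s t && h s)); last first.
  apply: eq_bigr => s _; rewrite /P; case Us: (U s); last by rewrite big1.
  rewrite -degU //=; case: (h s); last by rewrite /= big1 // => t _; rewrite andbF.
  by apply: eq_bigr => t _; rewrite andbT.
rewrite big_filter big_enum_cond /= big_mkcond /=.
transitivity (\big[addb/false]_(p : V * V) ((P p.1 p.2 && (enum_rank p.1 < enum_rank p.2)%N && h p.1) (+)
    (P p.1 p.2 && (enum_rank p.1 < enum_rank p.2)%N && h p.2))).
  apply: eq_bigr => p _; rewrite /P -!andbA; case: ifP => [/and4P[-> -> -> ->] //|].
  by case: (U p.1); case: (U p.2); case: (e p.1 p.2); case: (_ < _)%N.
rewrite big_split /=.
rewrite -(pair_bigA _ (fun s t => P s t && (enum_rank s < enum_rank t)%N && h s)) /=.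
rewrite -(pair_bigA _ (fun s t => P s t && (enum_rank s < enum_rank t)%N && h t)) /=.
rewrite [X in _ (+) X]exchange_big -big_split; apply: eq_bigr => s _ /=.
rewrite -big_split; apply: eq_bigr => t _ /=; rewrite [P t s]P_sym.
case: ltngtP => [_|_|/val_inj/enum_rank_inj ->]; rewrite ?andbT ?andbF ?addbF //.
by rewrite /P e_irr !andbF.
Qed.

(* Otherwise [v], its twin and a further neighbour [y] of [a], against [a], its twin and
   [c], form a K33 missing the edge [yc].  The missing edge is replaced by the subgraph
   induced on one vertex from each of the other twin pairs: there [y] and [c] have odd
   degree and all other vertices even degree. *)
Lemma adjacent_pairs v a c : e v a -> e v c -> c != a -> c != twin a -> e a c.
Proof.
(* [T] selects one vertex of each twin pair. *)
pose T x := (enum_rank x <= enum_rank (twin x))%N.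
have T_twin x : T (twin x) = ~~ T x.
  rewrite /T twinK -ltnNge ltn_neqAle -[X in _ = X && _]negbK.
  by rewrite (inj_eq val_inj) (inj_eq enum_rank_inj) twin_neq.
move=> va.
wlog Tc : c / T c.
  move=> hw vc ca cta; case Tc: (T c); first exact: hw.
  rewrite -e_twinr; apply: hw; rewrite ?T_twin ?Tc ?e_twinr //.
    by rewrite -(inj_eq (inv_inj twinK)) twinK.
  by rewrite (inj_eq (inv_inj twinK)).
move=> vc ca cta; apply: contraT => nac; exfalso.
have [y [Ty ay yv ytv]] : exists y, [/\ T y, e a y, y != v & y != twin v].
  have [y ay /andP[yv ytv]] := nbr_exists a v.
  case Ty: (T y); first by exists y.
  exists (twin y); rewrite T_twin Ty e_twinr ay; split=> //.
    by rewrite -(inj_eq (inv_inj twinK)) twinK.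
  by rewrite (inj_eq (inv_inj twinK)).
have av : e a v by rewrite e_sym.
have ac : a != c by rewrite eq_sym.
have Nv := nbrE va vc ac cta.
have Na := nbrE av ay _ ytv; rewrite eq_sym in Na; have {}Na := Na yv.
pose base := [:: v; twin v; a; twin a].
have uq_base : uniq base.
  apply: twin_pairs_uniq; first by apply: contraTneq va => ->; rewrite e_irr.
  by apply: contraTneq va => ->; rewrite e_twinr e_irr.
pose U x := T x && (x \notin base).
have Uc : U c.
  rewrite /U Tc !inE !negb_or ca cta !andbT /=; apply/andP; split.
    by apply: contraTneq vc => ->; rewrite e_irr.
  by apply: contraTneq vc => ->; rewrite e_twinr e_irr.
have Uy : U y.
  rewrite /U Ty !inE !negb_or yv ytv /=; apply/andP; split.
    by apply: contraTneq ay => ->; rewrite e_irr.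
  by apply: contraTneq ay => ->; rewrite e_twinr e_irr.
have yc : y != c by apply: contraTneq ay => ->.
(* The neighbours of [s] form two twin pairs, so exactly two of them are selected. *)
have degT s : \big[addb/false]_t (T t && e s t) = false.
  have [p sp _] := nbr_exists s s; have [q sq /andP[qp qtp]] := nbr_exists s p.
  rewrite eq_sym in qp; under eq_bigr do rewrite andbC (nbrE sp sq qp qtp).
  rewrite addb_mem_uniq; last exact: twin_pairs_uniq.
  by rewrite !big_cons big_nil !T_twin; case: (T p); case: (T q).
have degU s : U s -> \big[addb/false]_t (U t && e s t) = (s == y) (+) (s == c).
  (* Leaving out [base] removes one selected vertex from the pair of [v] and one from that of [a].
     Within [U] only [c] is adjacent to [v] and only [y] to [a]. *)
  move=> /andP[Ts s_base]; transitivity (e s v (+) e s a).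
    transitivity (\big[addb/false]_t ((T t && e s t) (+) ((t \in base) && (T t && e s t)))).
      by apply: eq_bigr => t _; rewrite /U; case: (T t); case: (e s t); case: (t \in base).
    rewrite big_split /= degT addFb addb_mem_uniq // !big_cons big_nil !T_twin !e_twinr.
    by case: (T v); case: (T a); case: (e s v); case: (e s a).
  have not_twin x : T x -> (s == twin x) = false.
    by move=> Tx; apply: contraTF Ts => /eqP->; rewrite T_twin Tx.
  rewrite [e s v]e_sym [e s a]e_sym Nv Na.
  move: s_base; rewrite !inE !negb_or => /and4P[/negbTE-> /negbTE-> /negbTE-> /negbTE->] /=.
  by rewrite !not_twin // !orbF addbC.
pose Z := [seq p <- enum {: V * V} |
  [&& U p.1, U p.2, e p.1 p.2 & (enum_rank p.1 < enum_rank p.2)%N]].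
have bdZ : chain_boundary Z y c by exact: chain_boundary_subgraph.
have ZP p : p \in Z -> [/\ U p.1, U p.2 & e p.1 p.2].
  by rewrite mem_filter => /andP[/and4P[]].
pose W p := if p == (y, c) then Z else [:: p].
have bdW u w : chain_boundary (W (u, w)) u w.
  by rewrite /W; case: eqP => [[-> ->] //|_]; exact: chain_boundary1.
pose A := [:: v; twin v; y]; pose B := [:: a; twin a; c].
have eAB u w : u \in A -> w \in B -> (u, w) != (y, c) -> e u w.
  rewrite !inE xpair_eqE => /or3P[]/eqP-> /or3P[]/eqP->; rewrite ?eqxx // => _;
    by rewrite ?e_twinl ?e_twinr // e_sym.
(* Edges of the K33 disjoint from yc lie inside [base], so they avoid the replacement subgraph. *)
have sub_base u w : u \in A -> w \in B -> u != y -> w != c -> (u \in base) && (w \in base).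
  by rewrite !inE => /or3P[]/eqP-> /or3P[]/eqP->; rewrite ?eqxx ?orbT.
have uqAB : uniq (A ++ B).
  have nU x : U x -> x \notin base by case/andP.
  have := nU y Uy; have := nU c Uc; have := uq_base.
  rewrite /= !inE !negb_or !andbT => /and3P[/and3P[-> -> ->] /andP[-> ->] ->].
  move=> /and4P[cv ctv _ _] /and4P[_ _ ya yta].
  by rewrite ![v == _]eq_sym ![twin v == _]eq_sym yv ytv cv ctv ya yta yc eq_sym ca eq_sym cta.
have neqAB u w : u \in A -> w \in B -> u != w.
  move: uqAB; rewrite cat_uniq => /and3P[_ /hasPn AB _] uA wB.
  by apply: contraNneq (AB w wB) => <-.
have neq_base x p : U x -> p \in base -> x != p.
  by move=> /andP[_ xb]; apply: contraTneq => <-.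
apply: (@van_kampen_K33 V lt (fun p => chain_sum f (W p)) v (twin v) y a (twin a) c) => //.
move=> u w u' w' uA wB uA' wB' uu' ww'; apply: chain_crossing => // p p'.
rewrite /W; case: eqP => [[uy wc]|/eqP n1]; case: eqP => [[uy' wc']|/eqP n2].
- by rewrite uy uy' eqxx in uu'.
- rewrite inE => /ZP[U1 U2 ep] /eqP->; apply: vk => //=; first exact: eAB.
  have /andP[b1 b2] : (u' \in base) && (w' \in base).
    by apply: sub_base => //; rewrite -?uy -?wc eq_sym.
  by split; exact: neq_base.
- rewrite inE => /eqP-> /ZP[U1 U2 ep]; apply: vk => //=; first exact: eAB.
  have /andP[b1 b2] : (u \in base) && (w \in base).
    by apply: sub_base => //; rewrite -?uy' -?wc'.
  by split; rewrite eq_sym; exact: neq_base.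
- rewrite !inE => /eqP-> /eqP->; apply: vk; rewrite /= ?eAB //; split=> //=.
    exact: neqAB.
  by rewrite eq_sym; exact: neqAB.
Qed.

(** A vertex and two neighbours from different twin pairs give three twin pairs, completely joined
    to each other by [adjacent_pairs]. Every degree is then exhausted, so such a block is closed
    under adjacency and two blocks are equal or disjoint. *)
Lemma union_of_octahedra_of_even_codegree : union_of_octahedra e.
Proof.
have exq v : exists q : V * V, [/\ e v q.1, e v q.2, q.2 != q.1 & q.2 != twin q.1].
  have [a va _] := nbr_exists v v; have [c vc /andP[ca cta]] := nbr_exists v a.
  by exists (a, c).
have [q qP] := fin_all_exists exq.
pose corner v n := nth v [:: v; (q v).1; (q v).2] n.
(* Vertices 2k and 2k+1 of [octahedron] are nonadjacent; they become a corner and its twin. *)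
pose vertex v (j : 'I_6) := if odd j then twin (corner v j./2) else corner v j./2.
pose block v := [set vertex v j | j : 'I_6]%SET.
have e_vertex v (j j' : 'I_6) : e (vertex v j) (vertex v j') = octahedron j j'.
  have [va vc ca cta] := qP v; have ac := adjacent_pairs va vc ca cta.
  have -> : e (vertex v j) (vertex v j') = e (corner v j./2) (corner v j'./2).
    by rewrite /vertex; case: (odd j); case: (odd j'); rewrite ?e_twinl ?e_twinr.
  have -> : octahedron j j' = (j./2 != j'./2).
    by rewrite /octahedron /= -val_eqE; case: eqVneq => [->|]; rewrite ?eqxx.
  have : (j./2 < 3)%N by case: j => -[|[|[|[|[|[|]]]]]].
  have : (j'./2 < 3)%N by case: j' => -[|[|[|[|[|[|]]]]]].
  case: (j./2) => [|[|[|//]]]; case: (j'./2) => [|[|[|//]]] _ _ /=;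
    by rewrite ?e_irr ?va ?vc ?ac // e_sym ?va ?vc ?ac.
have vertex_inj v : injective (vertex v).
  move=> j j' jj'; have := e_vertex v j j'; rewrite jj' e_irr /octahedron /=.
  move=> /esym/negbT; rewrite negb_and !negbK => /orP[/eqP//|/eqP half_eq].
  move: jj'; rewrite /vertex half_eq.
  have [odd_eq _|] := eqVneq (odd j) (odd j').
    by apply: val_inj; rewrite -[val j]odd_double_half -[val j']odd_double_half odd_eq half_eq.
  case: (odd j); case: (odd j') => // _ /eqP; first by rewrite (negbTE (twin_neq _)).
  by rewrite eq_sym (negbTE (twin_neq _)).
have twin_block v x : x \in block v -> twin x \in block v.
  case/imsetP => j _ ->.
  have [j' j'E] : exists j' : 'I_6, (if odd j then j.-1 else j.+1) = j'.
    have lt6 : ((if odd j then j.-1 else j.+1) < 6)%N by case: j => -[|[|[|[|[|[|]]]]]].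
    by exists (Ordinal lt6).
  apply/imsetP; exists j' => //; rewrite /vertex -j'E.
  by case: j j'E => -[|[|[|[|[|[|]]]]]] //= _ _; rewrite ?twinK.
have corner_block v n : (n < 3)%N -> corner v n \in block v.
  move=> n3; have lt_n : (n.*2 < 6)%N by rewrite -[6%N]/(3.*2) ltn_double.
  by apply/imsetP; exists (Ordinal lt_n); rewrite // /vertex /= odd_double doubleK.
have nbr_block v w x : w \in block v -> e w x -> x \in block v.
  have [va vc ca cta] := qP v; have ac := adjacent_pairs va vc ca cta.
  have av : e (q v).1 v by rewrite e_sym.
  have cv : e (q v).2 v by rewrite e_sym.
  have c_a : e (q v).2 (q v).1 by rewrite e_sym.
  have neq x0 y0 : e x0 y0 -> (x0 != y0) && (y0 != twin x0).
    move=> xy; apply/andP; split; apply: contraTneq xy => ->; rewrite ?e_twinr e_irr //.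
  have [n1 n2] := andP (neq _ _ va); have [n3 n4] := andP (neq _ _ vc).
  have aq : (q v).1 != (q v).2 by rewrite eq_sym.
  have pairs_block m n y : (m < 3)%N -> (n < 3)%N ->
      y \in [:: corner v m; twin (corner v m); corner v n; twin (corner v n)] -> y \in block v.
    by move=> m3 n3'; rewrite !inE => /or4P[]/eqP->; rewrite ?twin_block ?corner_block.
  have corner_nbr n : (n < 3)%N -> e (corner v n) x -> x \in block v.
    case: n => [|[|[|//]]] _ /=.
    - by rewrite (nbrE va vc aq cta); apply: (pairs_block 1%N 2%N).
    - by rewrite (nbrE av ac n3 n4); apply: (pairs_block 0%N 2%N).
    - by rewrite (nbrE cv c_a n1 n2); apply: (pairs_block 0%N 1%N).
  case/imsetP => j _ ->; have j3 : (j./2 < 3)%N by case: j => -[|[|[|[|[|[|]]]]]].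
  by rewrite /vertex; case: odd; rewrite ?e_twinl; exact: corner_nbr.
have mem_block v : v \in block v by exact: (corner_block v 0%N).
have block_eq v w : w \in block v -> block w = block v.
  move=> wv; apply/eqP; rewrite finset.eqEcard !card_imset // leqnn andbT.
  have [wa wc _ _] := qP w.
  apply/fintype.subsetP => _ /imsetP[j _ ->]; rewrite /vertex.
  have corner_v n : corner w n \in block v.
    case: n => [|[|[|n]]] //=; [exact: nbr_block wa|exact: nbr_block wc|].
    by rewrite /corner /= nth_nil.
  by case: odd; rewrite ?twin_block.
pose blocks := [set block v | v : V]%SET.
have exr (i : 'I_#|blocks|) : exists v, enum_val i = block v.
  by have /imsetP[v _ ->] := enum_valP i; exists v.
have [r rP] := fin_all_exists exr.
pose g (p : 'I_#|blocks| * 'I_6) := vertex (r p.1) p.2.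
have g_block p : g p \in block (r p.1) by apply: imset_f.
have g_inj : injective g.
  move=> [i j] [i' j'] gg; have ii' : i = i'.
    apply: enum_val_inj; rewrite !rP; have := g_block (i, j); rewrite gg => /block_eq /= <-.
    exact/block_eq/(g_block (i', j')).
  by move: gg; rewrite ii' /g /= => /vertex_inj ->.
have g_surj x : exists p, g p = x.
  have xB : block x \in blocks by apply: imset_f.
  have : x \in block (r (enum_rank_in xB (block x))).
    by rewrite -rP enum_rankK_in // mem_block.
  by case/imsetP => j _ ->; exists (enum_rank_in xB (block x), j).
have [h hK] := fin_all_exists g_surj.
have gK : cancel g h by move=> p; apply: g_inj; rewrite hK.
exists #|blocks|, h; split; first by exists g.
move=> u v; rewrite -[in RHS](hK u) -[in RHS](hK v).
case: (h u) (h v) => [i j] [i' j']; rewrite /copies /=.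
have [->|ii'] := eqVneq i i'; first by rewrite e_vertex.
apply/esym/negbTE; apply: contra ii' => /(nbr_block _ _ _ (g_block (i, j))) gB.
apply/eqP/enum_val_inj; rewrite !rP -(block_eq _ _ gB).
exact/block_eq/(g_block (i', j')).
Qed.

End EvenCodegree.

(** * Perfect matchings of octahedra *)

(** A matching is encoded by its partner function, which can be prescribed separately on each
    component. *)
Lemma leq_card_partners (V : finType) (e : rel V) (X : {set {ffun V -> V}}) :
    irreflexive e ->
    (forall p, p \in X -> involutive p /\ forall x, e x (p x)) ->
  (#|X| <= num_perfect_matchings e)%N.
Proof.
move=> e_irr XP; pose M (p : {ffun V -> V}) := [set [set x; p x] | x : V]%SET.
have pairE p x y : p \in X -> x \in [set y; p y]%SET -> [set y; p y]%SET = [set x; p x]%SET.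
  move=> /XP[pK _]; rewrite !inE => /orP[]/eqP-> //.
  by rewrite pK finset.setUC.
rewrite -(card_in_imset (f := M)); last first.
  move=> p p' pX p'X MM; apply/ffunP => x.
  have : [set x; p x]%SET \in M p' by rewrite -MM; exact: imset_f.
  case/imsetP => y _ xy.
  have {}xy : [set x; p x]%SET = [set x; p' x]%SET.
    by rewrite xy; apply: pairE => //; rewrite -xy !inE eqxx.
  have [_ ep] := XP p pX; have : p x \in [set x; p' x]%SET by rewrite -xy !inE eqxx orbT.
  rewrite !inE => /orP[]/eqP // px; have := ep x.
  by rewrite px e_irr.
apply/subset_leq_card/fintype.subsetP => _ /imsetP[p pX ->].
have [pK ep] := XP p pX; rewrite inE; apply/andP; split.
  apply/fintype.subsetP => _ /imsetP[x _ ->]; apply/imsetP.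
  by exists (x, p x) => //; rewrite inE.
apply/and3P; split.
- apply/eqP/setP => x; rewrite inE; apply/bigcupP; exists [set x; p x]%SET; last first.
    by rewrite !inE eqxx.
  exact: imset_f.
- apply/finset.trivIsetP => _ _ /imsetP[x _ ->] /imsetP[y _ ->] xy.
  rewrite -setI_eq0; apply: contraNT xy => /set0Pn[z]; rewrite inE => /andP[zx zy].
  by rewrite (pairE p z x pX zx) (pairE p z y pX zy).
- apply/imsetP => -[x _] /setP/(_ x).
  by rewrite !inE eqxx.
Qed.

(* One row for each perfect matching; entry [j] is the vertex matched with [j]. *)
Definition octahedron_partners : seq (seq nat) :=
  [:: [:: 2; 4; 0; 5; 1; 3]; [:: 2; 5; 0; 4; 3; 1]; [:: 3; 4; 5; 0; 1; 2];
      [:: 3; 5; 4; 0; 2; 1]; [:: 4; 2; 1; 5; 0; 3]; [:: 4; 3; 5; 1; 0; 2];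
      [:: 5; 2; 1; 4; 3; 0]; [:: 5; 3; 4; 1; 2; 0]]%N.

Definition octahedron_partner_nat (b j : nat) : nat := nth 0%N (nth [::] octahedron_partners b) j.

Lemma octahedron_partner_natP (b : 'I_8) (j : 'I_6) (t := octahedron_partner_nat b) :
  [&& (t j < 6)%N, t (t j) == j, t j != j & (t j)./2 != j./2].
Proof.
have /allP/(_ b) : all (fun b => all (fun j => let t := octahedron_partner_nat b in
    [&& (t j < 6)%N, t (t j) == j, t j != j & (t j)./2 != j./2]) (iota 0 6)) (iota 0 8) by [].
by rewrite mem_iota ltn_ord => /(_ isT)/allP/(_ j); rewrite mem_iota ltn_ord => /(_ isT).
Qed.

Lemma octahedron_partner_nat_inj (b b' : 'I_8) :
  (forall j : 'I_6, octahedron_partner_nat b j = octahedron_partner_nat b' j) -> b = b'.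
Proof.
(* The partners of 0 and 1 already tell the eight rows apart. *)
move=> bb; have /allP/(_ b) : all (fun b => all (fun b' =>
    all (fun j => octahedron_partner_nat b j == octahedron_partner_nat b' j) (iota 0 2) ==> (b == b'))
    (iota 0 8)) (iota 0 8) by [].
rewrite mem_iota ltn_ord => /(_ isT)/allP/(_ b'); rewrite mem_iota ltn_ord => /(_ isT)/implyP h.
apply/val_inj/eqP/h/allP => j; rewrite mem_iota => /andP[_ j2]; apply/eqP.
exact: (bb (Ordinal (leq_trans j2 (isT : (0 + 2 <= 6)%N)))).
Qed.

Definition octahedron_partner (b : 'I_8) (j : 'I_6) : 'I_6 := inord (octahedron_partner_nat b j).

Lemma octahedron_partnerE b j :
  octahedron_partner b j = octahedron_partner_nat b j :> nat.
Proof. by rewrite inordK //; have /and4P[] := octahedron_partner_natP b j. Qed.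

Lemma octahedron_partnerK b : involutive (octahedron_partner b).
Proof.
move=> j; apply: val_inj; rewrite /= !octahedron_partnerE.
by have /and4P[_ /eqP] := octahedron_partner_natP b j.
Qed.

Lemma octahedron_partner_edge b j : octahedron j (octahedron_partner b j).
Proof.
rewrite /octahedron /= -val_eqE /= octahedron_partnerE [nat_of_ord j == _]eq_sym [j./2 == _]eq_sym.
by have /and4P[_ _ -> ->] := octahedron_partner_natP b j.
Qed.

Lemma octahedron_partner_inj b b' :
  octahedron_partner b =1 octahedron_partner b' -> b = b'.
Proof.
by move=> bb; apply: octahedron_partner_nat_inj => j; rewrite -!octahedron_partnerE bb.
Qed.

Lemma octahedra_matchings (V : finType) (e : rel V) k :
    irreflexive e -> isomorphic e (@copies k _ octahedron) ->
  #|V| = (k * 6)%N /\ (8 ^ k <= num_perfect_matchings e)%N.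
Proof.
move=> e_irr [h [h_bij hE]]; have [g hK gK] := h_bij; split.
  by rewrite (bij_eq_card h_bij) card_prod !card_ord.
pose p (c : {ffun 'I_k -> 'I_8}) : {ffun V -> V} :=
  [ffun x => g ((h x).1, octahedron_partner (c (h x).1) (h x).2)].
have p_inj : injective p.
  move=> c c' pp; apply/ffunP => i; apply: octahedron_partner_inj => j.
  have /ffunP/(_ (g (i, j))) := pp; rewrite !ffunE gK /= => /(can_inj gK).
  by case.
rewrite -[8%N]card_ord -[k in (_ ^ k)%N]card_ord -card_ffun.
rewrite -(card_imset predT p_inj); apply: leq_card_partners => // _ /imsetP[c _ ->].
split=> x; rewrite !ffunE.
  by rewrite gK /= octahedron_partnerK -surjective_pairing hK.
by rewrite -hE gK /copies /= eqxx octahedron_partner_edge.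
Qed.

Lemma four_powR_quarter (R : realType) m : (4 : R) `^ (m.*2%:R / 4) = (2 ^ m)%:R.
Proof.
have -> : (4 : R) = 2 `^ 2%:R by rewrite powR_mulrn //; ring.
rewrite -powRrM (_ : _ * _ = m%:R) ?powR_mulrn ?natrX //.
by rewrite -muln2 natrM; field.
Qed.

Theorem theorem4p2 (R : realType) (V : finType) (e : rel V)
    (e_sym : symmetric e) (e_irr : irreflexive e)
    (e_reg : regular_graph e 4) (V_even : ~~ odd #|V|) :
  (pfaffian e ->
     (num_perfect_matchings e)%:R <= (4 : R) `^ (#|V|%:R / 4)) /\
  (planar R e ->
     ((num_perfect_matchings e)%:R = (4 : R) `^ (#|V|%:R / 4)
      <-> union_of_octahedra e)).
Proof.
have cardV : #|V| = (#|V|./2).*2 by rewrite -[LHS]odd_double_half (negbTE V_even).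
move: (#|V|./2) cardV => m cardV.
have sqr4 n : ((n ^ 2 <= 4 ^ m) = (n <= 2 ^ m))%N /\ ((n ^ 2 == 4 ^ m) = (n == 2 ^ m))%N.
  by rewrite -[4%N]/((2 ^ 2)%N) -expnM mulnC expnM leq_exp2r // eqn_exp2r.
rewrite cardV four_powR_quarter ler_nat; split.
  by move=> /(pfaffian_bound e_sym e_reg)/(_ cardV); have [->] := sqr4 (num_perfect_matchings e).
move=> /(planar_van_kampen e_sym)[lt [f [lt_t f_sym vk]]].
have [le_num codeg] := van_kampen_bound e_sym e_irr e_reg lt_t f_sym vk cardV.
split=> [/eqP|[k iso]].
  rewrite eqr_nat; have [_ <-] := sqr4 (num_perfect_matchings e) => /eqP/codeg codeg_even.
  exact: (union_of_octahedra_of_even_codegree e_sym e_irr e_reg lt_t vk codeg_even).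
have [cardk le_k] := octahedra_matchings e_irr iso.
apply/eqP; rewrite eqr_nat eqn_leq; have [<- _] := sqr4 (num_perfect_matchings e).
rewrite le_num; apply: leq_trans le_k.
(* From 6k = 2m one gets m = 3k, so 8 ^ k is exactly the upper bound 2 ^ m. *)
rewrite -[8%N]/((2 ^ 3)%N) -expnM leq_exp2l //.
by move: cardk; rewrite cardV; lia.
Qed.
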